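(* Let $\widetilde T=-E+H+X-SXS+Y-U^2YU+Z-U^2ZU\in\widehat{\mathcal R}$ (with $E,H,X,Y,Z$ as in the context), and write $\widetilde T=\sum_{n\ge1}\widetilde T_n$ with $\widetilde T_n\in\mathbb Q[\mathcal M_n]$. Then (a) $\widetilde T\pi_S\in\pi_U\widehat{\mathcal R}$ and $\widetilde T\pi_U\in\pi_S\widehat{\mathcal R}$; equivalently, for each $n$, $\widetilde T_n(1+S)\in(1+U+U^2)\mathbb Q[\mathcal M_n]$ and $\widetilde T_n(1+U+U^2)\in(1+S)\mathbb Q[\mathcal M_n]$; (b) $\langle\widetilde T,K\rangle=-1$ for every right coset $K=M\Gamma$, $M\in\mathcal M$.
   Context: Let $\Gamma=\mathrm{PSL}_2(\mathbb Z)$, $S=\pm\begin{pmatrix}0&-1\\1&0\end{pmatrix}$, $U=\pm\begin{pmatrix}1&-1\\1&0\end{pmatrix}$, $\pi_S=(1+S)/2$, $\pi_U=(1+U+U^2)/3$ ($1$ = identity). Let $\mathcal M_n$ be the set of integer $2\times2$ matrices of determinant $n$ modulo $\pm1$, $\mathcal M=\bigcup_n\mathcal M_n$, and $\widehat{\mathcal R}=\prod_{n\ge1}\mathbb Q[\mathcal M_n]$, formal $\mathbb Q$-linear combinations of elements of $\mathcal M$ with finitely many terms of each determinant; $\mathbb Q[\Gamma]$ acts on both sides by matrix multiplication. For $\xi=\sum c_MM$ and $\mathcal S\subset\mathcal M$, $\langle\xi,\mathcal S\rangle=\sum_{M\in\mathcal S}c_M$. Elements of $\mathcal M$ are represented by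 $M=\begin{pmatrix}a&b\\c&d\end{pmatrix}$ with $c\ge0$. Notation $\left\langle{L_1\atop L_2}\right\rangle$, for two lines of inequalities in $a,b,c,d$: the formal sum $\sum c(M)M$ over such $M$ satisfying all inequalities, with $c(M)=1$ if no inequality of the first line $L_1$ is an equality, $1/2$ if exactly one is, and if exactly two are, $1/4$, $1/3$, $1/6$ according as they are independent ($A\le B$, $C\le D$), overlapping ($A\le B$, $A\le C$) or nested ($A\le B\le C$). Let $\mathcal F=\{z\in\mathbb H:0\le\operatorname{Re}z\le1/2,\ |z-1|\ge1\}$, $\chi(z)=1/(2\pi)$ times the angle subtended by $\mathcal F$ at $z$; for elliptic $M$ ($\operatorname{tr}(M)^2<4\det M$) let $z_M\in\mathbb H$ be its fixed point. Define $E=\sum_{M\text{ elliptic}}\chi(z_M)M$, $H=\left\langle{a-d\le-b\le c\atop c=0<a}\right\rangle$, $X=\left\langle{0\le a-d;\ -b\le c\atop b<0<d}\right\rangle$, $Y=\left\langle{a-d\le-b\le c\atop 0<c<a}\right\rangle$, $Z=\left\langle{a-d\le c\le-b\atop 0<a;\ 0<c}\right\rangle$. (The element $\widetilde T$ indeed lies in $\widehat{\mathcal R}$.) *)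

(* Defs.v *)
From HB Require Import structures.
From mathcomp Require Import all_boot all_order all_algebra.
From mathcomp Require Import complex.
From mathcomp Require Import all_classical all_reals all_analysis.
Set Implicit Arguments.
Unset Strict Implicit.
Unset Printing Implicit Defensive.
Import Order.TTheory GRing.Theory Num.Theory.
Import numFieldNormedType.Exports.
Local Open Scope classical_set_scope.
Local Open Scope ring_scope.

(** Integer matrices of positive determinant modulo +-1: each class {A, -A} is
    encoded by its unique representative whose bottom-left entry c is positive,
    or is 0 with the top-left entry a positive (when c = 0, the determinant
    ad > 0 forces a <> 0). *)
Definition pos_rep (A : 'M[int]_2) : bool :=
  (0 < A 1 0) || ((A 1 0 == 0) && (0 < A 0 0)).

Record matpm := MatPM {
  rep :> 'M[int]_2;
  matpmP : (0 < \det rep) && pos_rep rep }.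
HB.instance Definition _ := [isSub for rep].
HB.instance Definition _ := [Choice of matpm by <:].

Lemma one_matpmP : (0 < \det (1%:M : 'M[int]_2)) && pos_rep 1%:M.
Proof. by rewrite det1 /pos_rep !mxE. Qed.
Definition Mone : matpm := MatPM one_matpmP.

(** The class of A modulo +-1; a junk value when [\det A <= 0]. *)
Definition pm (A : 'M[int]_2) : matpm :=
  insubd Mone (if pos_rep A then A else - A).

Lemma det2 (A : 'M[int]_2) : \det A = A 0 0 * A 1 1 - A 0 1 * A 1 0.
Proof.
rewrite (expand_det_row _ 0) !big_ord_recl big_ord0 addr0 /cofactor !det_mx11.
rewrite !mxE /= expr0 mul1r expr1 mulN1r mulrN.
have -> : lift (0 : 'I_2) (0 : 'I_1) = 1 by apply/val_inj.
have -> : lift (1 : 'I_2) (0 : 'I_1) = 0 by apply/val_inj.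
by [].
Qed.

Lemma pos_repN (A : 'M[int]_2) : 0 < \det A -> pos_rep (- A) = ~~ pos_rep A.
Proof.
rewrite det2 /pos_rep !mxE !oppr_gt0 oppr_eq0.
case: (ltgtP (A 1 0) 0) => //= ->; rewrite mulr0 subr0.
by case: (ltgtP (A 0 0) 0) => //= ->; rewrite mul0r ltxx.
Qed.

Lemma rep_pm (A : 'M[int]_2) : 0 < \det A ->
  rep (pm A) = if pos_rep A then A else - A.
Proof.
move=> dA; rewrite /pm; apply: insubdK; rewrite unfold_in /=.
case: ifPn => hA; first by rewrite dA.
by rewrite pos_repN // hA det2 !mxE !mulrNN -det2 dA.
Qed.

Lemma repK (M : matpm) : pm M = M.
Proof.
have /andP[dM hM] := matpmP M.
by apply: val_inj; rewrite /= rep_pm // hM.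
Qed.

Lemma eq_pm (A B : 'M[int]_2) : 0 < \det A -> 0 < \det B ->
  pm A = pm B <-> A = B \/ A = - B.
Proof.
move=> dA dB; split=> [/(congr1 rep)|AB].
  rewrite !rep_pm //; case: ifP => _; case: ifP => _.
  - by left.
  - by right.
  - by move=> <-; right; rewrite opprK.
  - by move/oppr_inj; left.
apply: val_inj; rewrite /= !rep_pm //.
case: AB => [->//|AB]; move: dA; rewrite AB => dA.
by rewrite pos_repN //; case: (pos_rep B); rewrite /= ?opprK.
Qed.

Definition Mmul (M N : matpm) : matpm := pm (rep M *m rep N).

Definition mx2 (a b c d : int) : 'M[int]_2 :=
  \matrix_(i, j) if i == 0 then (if j == 0 then a else b)
                 else (if j == 0 then c else d).

Definition Smat : matpm := pm (mx2 0 (-1) 1 0).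
Definition Umat : matpm := pm (mx2 1 (-1) 1 0).

Definition detn (n : nat) : set matpm := [set M | \det (rep M) = n%:Z].
Definition Gamma : set matpm := detn 1.

Section FormalSums.
Context {R : realType}.

(** A formal sum is its coefficient function.  Coefficients live in R because
    the angle [chi] below is real; rationality is part of [Rhat] and [QM]. *)
Definition formal := matpm -> R.

Definition rational_coefs (xi : formal) :=
  forall M, exists q : rat, xi M = ratr q.

(** The product over n >= 1 of the spaces Q[M_n]. *)
Definition Rhat : set formal := [set xi | rational_coefs xi /\
  forall n : nat, finite_set [set M | detn n M /\ xi M != 0]].

Definition QM (n : nat) : set formal := [set xi | [/\ rational_coefs xi,
  finite_set [set M | xi M != 0] & forall M, xi M != 0 -> detn n M]].

Definition component (n : nat) (xi : formal) : formal :=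
  fun M => if \det (rep M) == n%:Z then xi M else 0.

(** Formal product (sum x_M M)(sum y_N N) = sum x_M y_N MN; on the formal sums
    supported on PSL_2(Z), it restricts to the left and right actions of
    Q[PSL_2(Z)]. *)
Definition fmul (xi eta : formal) : formal :=
  fun N => \sum_(p \in [set p : matpm * matpm | Mmul p.1 p.2 = N])
             (xi p.1 * eta p.2).

Definition single (M : matpm) : formal := fun N => (N == M)%:R.

Definition fone : formal := single Mone.
Definition fS : formal := single Smat.
Definition fU : formal := single Umat.
Definition fU2 : formal := single (Mmul Umat Umat).

Definition piS : formal := fun M => (fone + fS) M / 2.
Definition piU : formal := fun M => (fone + fU + fU2) M / 3.

Definition pairing (xi : formal) (K : set matpm) : R := \sum_(M \in K) xi M.

(** Coefficient attached to two inequalities A <= B, C <= D, where w is the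
    value when both are equalities. *)
Definition weight2 (w : R) (A B C D : int) : R :=
  if (A <= B) && (C <= D) then
    if (A == B) && (C == D) then w
    else if (A == B) || (C == D) then 1 / 2 else 1
  else 0.
Definition independent (A B C D : int) : R := weight2 (1 / 4) A B C D.
Definition nested (A B C : int) : R := weight2 (1 / 6) A B B C.

(** [L1] gives the weight of the first line of inequalities, [L2] tests the
    second one. *)
Definition bracket (L1 : int -> int -> int -> int -> R)
    (L2 : int -> int -> int -> int -> bool) : formal :=
  fun M => let: (a, b, c, d) := (rep M 0 0, rep M 0 1, rep M 1 0, rep M 1 1) in
    if L2 a b c d then L1 a b c d else 0.

Definition fundF : set R[i] := [set z |
  [/\ 0 < complex.Im z, 0 <= complex.Re z <= 1 / 2 & 1 <= `|z - 1|]].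

(** The angle subtended at z by [fundF] is the measure of the set of directions
    pointing from z into it; in particular it is 0 when z is outside. *)
Definition directions (z : R[i]) : set R := [set t | 0 <= t < 2 * pi /\
  \forall s \near 0^'+, fundF (z + (s * cos t +i* (s * sin t))%C)].
Definition chi (z : R[i]) : R :=
  fine (lebesgue_measure (directions z)) / (2 * pi).

Definition elliptic (M : matpm) : bool :=
  (\tr (rep M)) ^+ 2 < 4 * \det (rep M).

Definition is_fixed_point (M : matpm) (z : R[i]) : Prop :=
  0 < complex.Im z /\
  ((rep M 0 0)%:~R * z + (rep M 0 1)%:~R) /
    ((rep M 1 0)%:~R * z + (rep M 1 1)%:~R) = z.

(** The fixed point in the upper half plane, unique when M is elliptic; a junk
    value if there is none. *)
Definition fixed_point (M : matpm) : R[i] := xget 0 (is_fixed_point M).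

Definition fE : formal :=
  fun M => if elliptic M then chi (fixed_point M) else 0.
Definition fH : formal := bracket
  (fun a b c d => nested (a - d) (- b) c)
  (fun a b c d => (c == 0) && (0 < a)).
Definition fX : formal := bracket
  (fun a b c d => independent 0 (a - d) (- b) c)
  (fun a b c d => (b < 0) && (0 < d)).
Definition fY : formal := bracket
  (fun a b c d => nested (a - d) (- b) c)
  (fun a b c d => (0 < c) && (c < a)).
Definition fZ : formal := bracket
  (fun a b c d => nested (a - d) c (- b))
  (fun a b c d => (0 < a) && (0 < c)).

Definition Ttilde : formal :=
  - fE + fH + fX - fmul (fmul fS fX) fS
  + fY - fmul (fmul fU2 fY) fU
  + fZ - fmul (fmul fU2 fZ) fU.

End FormalSums.
Arguments formal R : clear implicits.
Arguments Ttilde R : clear implicits.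

(* Main.v *)
Require Import Defs.
From HB Require Import structures.
From mathcomp Require Import all_boot all_order all_algebra.
From mathcomp Require Import complex.
From mathcomp Require Import all_classical all_reals all_analysis.
From mathcomp Require Import zify ring lra.
Set Implicit Arguments.
Unset Strict Implicit.
Unset Printing Implicit Defensive.
Import Order.TTheory GRing.Theory Num.Theory.
Import numFieldNormedType.Exports.
Local Open Scope classical_set_scope.
Local Open Scope ring_scope.

(** The angle [chi] only takes the values 0, 1/3, 1/2 and 1, so the coefficient
    of [Ttilde] at [[a, b], [c, d]] depends only on the signs of ten linear
    forms in a, b, c, d.

    An element lies in (1 + U + U^2) Q[M_n] as soon as it is invariant under
    left multiplication by U.  For [Ttilde] (1 + S) this invariance is a
    pointwise identity between four coefficients, i.e. a statement about the
    sign patterns of finitely many linear forms.  It is checked for all the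
    patterns that are consistent with ad - bc > 0 and with the three-term linear
    relations between the forms; these few constraints turn out to exclude
    every pattern for which the identity fails.  The invariance of
    [Ttilde] (1 + U + U^2) under S is obtained in the same way.

    Summing the two invariances over a right coset K gives
    <T, UK> = <T, K> = <T, SK>, so <T, M Gamma> only depends on the double coset
    Gamma M Gamma, and by elementary divisors one may take M = diag(me, e).
    There at most four elements of the coset have a nonzero coefficient. *)

(** * Coefficients as functions of the signs of linear forms *)

(* Twelve times the weight of two inequalities, as a function of the signs of
   the differences of their sides. *)
Definition wt (w : int) (k1 k2 : comparison) : int :=
  match k1, k2 with
  | Lt, _ | _, Lt => 0 | Eq, Eq => w | Eq, _ | _, Eq => 6 | _, _ => 12 end%R.

(* Twelve times [chi]: the last two arguments vanish together at the vertex
   e^(i pi/3) of the fundamental domain, whose angle is 2 pi/3. *)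
Definition wt3 (k k1 k2 : comparison) : int :=
  match k, k1, k2 with
  | Lt, _, _ | _, Lt, _ | _, _, Lt => 0
  | _, Eq, Eq => 4 | Eq, _, _ | _, Eq, _ | _, _, Eq => 6 | _, _, _ => 12 end%R.

Definition isgt k := if k is Gt then true else false.
Definition islt k := if k is Lt then true else false.
Definition iseq k := if k is Eq then true else false.
Local Notation opp := CompOpp.

(* The field [s_ad] is the sign of a - d, and likewise [s_bc] : b + c,
   [s_ac] : a - c, [s_bd] : b - d, [s_abd] : a + b - d, [s_acd] : a - c - d. *)
Record signs := Signs
  { s_a : comparison; s_b : comparison; s_c : comparison; s_d : comparison;
    s_ad : comparison; s_bc : comparison; s_ac : comparison; s_bd : comparison;
    s_abd : comparison; s_acd : comparison }.

Definition opps (s : signs) :=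
  let: Signs a b c d ad bc ac bd abd acd := s in
  Signs (opp a) (opp b) (opp c) (opp d) (opp ad) (opp bc) (opp ac) (opp bd)
    (opp abd) (opp acd).

Definition normal (s : signs) := isgt (s_c s) || iseq (s_c s) && isgt (s_a s).

(* Twelve times the coefficients of E, H, X, SXS, Y, U^2YU, Z and U^2ZU at the
   matrix [[a, b], [c, d]], assuming that it is the chosen representative modulo
   +-1.  The coefficient of U^2YU is that of Y at
   U [[a, b], [c, d]] U^-1 = +- [[d - b, a + b - c - d], [- b, a + b]]. *)
Definition coefE (s : signs) : int :=
  if isgt (s_c s) && islt (s_b s) then wt3 (s_ad s) (opp (s_acd s)) (opp (s_abd s)) else 0%R.
Definition coefH (s : signs) : int :=
  if iseq (s_c s) && isgt (s_a s) then wt 2 (opp (s_abd s)) (s_bc s) else 0%R.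
Definition coefX (s : signs) : int :=
  if islt (s_b s) && isgt (s_d s) then wt 3 (s_ad s) (s_bc s) else 0%R.
Definition coefSXS (s : signs) : int :=
  if isgt (s_c s) && isgt (s_a s) then wt 3 (opp (s_ad s)) (opp (s_bc s)) else 0%R.
Definition coefY (s : signs) : int :=
  if isgt (s_c s) && isgt (s_ac s) then wt 2 (opp (s_abd s)) (s_bc s) else 0%R.
Definition coefUYU (s : signs) : int :=
  if islt (s_b s) && isgt (s_d s) then wt 2 (s_bc s) (s_acd s) else 0%R.
Definition coefZ (s : signs) : int :=
  if isgt (s_a s) && isgt (s_c s) then wt 2 (opp (s_acd s)) (opp (s_bc s)) else 0%R.
Definition coefUZU (s : signs) : int :=
  if islt (s_b s) && islt (s_bd s) then wt 2 (s_abd s) (opp (s_acd s)) else 0%R.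

Definition coef_normal (s : signs) : int :=
  (- coefE s + coefH s + coefX s - coefSXS s + coefY s - coefUYU s + coefZ s - coefUZU s)%R.

Definition coef (s : signs) : int := if normal s then coef_normal s else coef_normal (opps s).

(** * Identities between coefficients, by enumeration of sign vectors *)

Definition cmpz (x : int) : comparison := if x < 0 then Lt else if x == 0 then Eq else Gt.

Variant cmpz_spec (x : int) : comparison -> Prop :=
| CmpzLt of x < 0 : cmpz_spec x Lt
| CmpzEq of x = 0 : cmpz_spec x Eq
| CmpzGt of 0 < x : cmpz_spec x Gt.

Lemma cmpzP x : cmpz_spec x (cmpz x).
Proof. by rewrite /cmpz; case: (ltgtP x 0) => h; constructor. Qed.

Lemma cmpzN x : cmpz (- x) = opp (cmpz x).
Proof. by case: (cmpzP x); case: (cmpzP (- x)) => //=; lia. Qed.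

Definition signs_of (a b c d : int) : signs :=
  Signs (cmpz a) (cmpz b) (cmpz c) (cmpz d) (cmpz (a - d)) (cmpz (b + c)) (cmpz (a - c))
    (cmpz (b - d)) (cmpz (a + b - d)) (cmpz (a - c - d)).

(** Exactly the sign triples that x, y and x + y can take: opposite signs of x and y leave the sum
    free, otherwise its sign is forced. *)
Definition sum_ok (x y z : comparison) : bool :=
  match x, y, z with
  | Lt, Gt, _ | Gt, Lt, _ => true
  | Lt, _, Lt | _, Lt, Lt | Gt, _, Gt | _, Gt, Gt | Eq, Eq, Eq => true
  | _, _, _ => false
  end.

Lemma sum_ok_cmpz x y : sum_ok (cmpz x) (cmpz y) (cmpz (x + y)).
Proof.
by case: (cmpzP x); case: (cmpzP y); case: (cmpzP (x + y)) => //=; lia.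
Qed.

Definition mulc (x y : comparison) :=
  match x with Lt => opp y | Eq => Eq | Gt => y end.

Lemma mulc_cmpz x y : mulc (cmpz x) (cmpz y) = cmpz (x * y).
Proof.
by case: (cmpzP x) => hx; case: (cmpzP y) => hy; case: (cmpzP (x * y)) => //=; nia.
Qed.

(* The tuple (p, q, r, s) stands for the linear form p a + q b + r c + s d. *)
Definition form := (int * int * int * int)%type.
Definition form_matrix := (form * form * form * form)%type.

Definition addf (f g : form) : form :=
  (f.1.1.1 + g.1.1.1, f.1.1.2 + g.1.1.2, f.1.2 + g.1.2, f.2 + g.2).
Definition oppf (f : form) : form := (- f.1.1.1, - f.1.1.2, - f.1.2, - f.2).
Definition subf (f g : form) : form := addf f (oppf g).

Definition formA : form := (1, 0, 0, 0).
Definition formB : form := (0, 1, 0, 0).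
Definition formC : form := (0, 0, 1, 0).
Definition formD : form := (0, 0, 0, 1).

(** * Enumeration of the sign vectors consistent with the linear relations *)

Section Enumeration.
Variable fs : seq form.
Let forms := [:: formA, formB, formC, formD & fs].

Definition signed_nth (i : nat * bool) : form :=
  let f := nth formA forms i.1 in if i.2 then oppf f else f.

Definition signed_sign (v : seq comparison) (i : nat * bool) : comparison :=
  let k := nth Eq v i.1 in if i.2 then opp k else k.

(* The ways to write the [k]-th form as a sum or difference of previous ones; an
   index is paired with [true] when the form is taken with a minus sign. *)
Definition decompositions (k : nat) : seq ((nat * bool) * (nat * bool)) :=
  let idx := [seq (i, e) | i <- iota 0 k, e <- [:: false; true]] in
  [seq ij <- [seq (i, j) | i <- idx, j <- idx] |
    (ij.1.1 < ij.2.1 < k)%N && (addf (signed_nth ij.1) (signed_nth ij.2) == nth formA forms k)].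

(* [if] rather than [==>], which would be strict when evaluated by the kernel. *)
Fixpoint all_extensions (test : pred (seq comparison))
    (table : seq (seq ((nat * bool) * (nat * bool)))) (v : seq comparison) : bool :=
  if table is r :: table' then
    all (fun s =>
      if all (fun ij => sum_ok (signed_sign v ij.1) (signed_sign v ij.2) s) r
      then all_extensions test table' (rcons v s) else true) [:: Lt; Eq; Gt]
  else test v.

Definition det_ok (a b c d : comparison) : bool :=
  sum_ok (mulc a d) (opp (mulc b c)) Gt.

(** Every choice of signs for the entries that the determinant allows is extended form by form. The
    decompositions do not depend on the signs and are tabulated once. *)
Definition all_sign_vectors (test : pred (seq comparison)) : bool :=
  let table := [seq decompositions k | k <- iota 4 (size fs)] in
  let cs := [:: Lt; Eq; Gt] in
  all (fun a => all (fun b => all (fun c => all (fun d =>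
    if det_ok a b c d then all_extensions test table [:: a; b; c; d] else true)
    cs) cs) cs) cs.

(** Forms are stored up to sign. If neither f nor -f is stored the index is out of range, a case
    that [covered] excludes. *)
Definition locate (f : form) : nat * bool :=
  if f \in forms then (index f forms, false) else (index (oppf f) forms, true).

Definition forms_of (m : form_matrix) : seq form :=
  let: (a, b, c, d) := m in
  [:: a; b; c; d; subf a d; addf b c; subf a c; subf b d; subf (addf a b) d;
      subf (subf a c) d].

Definition covered (m : form_matrix) : bool :=
  all (fun f => (f \in forms) || (oppf f \in forms)) (forms_of m).

Definition located_signs (v : seq comparison) (s : seq (nat * bool)) : signs :=
  if [seq signed_sign v i | i <- s] is [:: a; b; c; d; ad; bc; ac; bd; abd; acd]
  then Signs a b c d ad bc ac bd abd acd else Signs Eq Eq Eq Eq Eq Eq Eq Eq Eq Eq.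

Definition sum_coef (T : Type) (sg : T -> signs) (l : seq T) : int :=
  foldr (fun m r => coef (sg m) + r) 0 l.

Definition check_identity (l r : seq form_matrix) : bool :=
  let located := map (fun m => map locate (forms_of m)) in
  let l' := located l in let r' := located r in
  all covered (l ++ r) && all_sign_vectors (fun v =>
    sum_coef (located_signs v) l' == sum_coef (located_signs v) r').

Section Soundness.
Variables a b c d : int.
Hypothesis D : 0 < a * d - b * c.

Definition ev (f : form) : int := f.1.1.1 * a + f.1.1.2 * b + f.1.2 * c + f.2 * d.

Lemma ev_addf f g : ev (addf f g) = ev f + ev g.
Proof. by rewrite /ev /=; ring. Qed.

Lemma ev_oppf f : ev (oppf f) = - ev f.
Proof. by rewrite /ev /=; ring. Qed.

Lemma ev_subf f g : ev (subf f g) = ev f - ev g.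
Proof. by rewrite /subf ev_addf ev_oppf. Qed.

Let sv := [seq cmpz (ev f) | f <- forms].

Lemma signed_sign_ev k i : (i.1 < k <= size forms)%N ->
  signed_sign (take k sv) i = cmpz (ev (signed_nth i)).
Proof.
case/andP=> ik kn; rewrite /signed_sign /signed_nth nth_take //.
rewrite (nth_map formA) ?(leq_trans ik) //.
by case: i.2 => //; rewrite ev_oppf cmpzN.
Qed.

(** The signs realised by the integers a, b, c, d satisfy every constraint, so they form one of the
    branches on which the test was evaluated. *)
Lemma all_extensions_sound test n k : (k + n = size forms)%N ->
  all_extensions test [seq decompositions j | j <- iota k n] (take k sv) -> test sv.
Proof.
elim: n k => [|n IH] k kn /=; first by rewrite take_oversize // size_map -kn addn0.
have kf : (k < size forms)%N by rewrite -kn addnS ltnS leq_addr.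
move=> /and4P[h1 h2 h3 _]; apply: (IH k.+1); first by rewrite addSnnS.
rewrite (take_nth Eq) ?size_map //.
have : all (fun ij => sum_ok (signed_sign (take k sv) ij.1)
    (signed_sign (take k sv) ij.2) (nth Eq sv k)) (decompositions k).
  apply/allP => ij; rewrite mem_filter => /andP[/andP[/andP[ij1 ij2] /eqP E] _].
  rewrite !signed_sign_ev ?ij2 ?(ltn_trans ij1 ij2) ?(ltnW kf) //.
  by rewrite (nth_map formA) // -E ev_addf sum_ok_cmpz.
by case: (nth Eq sv k) => sk; [move: h2|move: h1|move: h3]; rewrite sk.
Qed.

Lemma all_sign_vectors_sound test : all_sign_vectors test -> test sv.
Proof.
have ok : det_ok (cmpz a) (cmpz b) (cmpz c) (cmpz d).
  by rewrite /det_ok !mulc_cmpz -cmpzN; have := sum_ok_cmpz (a * d) (- (b * c));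
    rewrite [cmpz (_ + _)](_ : _ = Gt) //; case: cmpzP => //; lia.
have sub (P : pred comparison) x : all P [:: Lt; Eq; Gt] -> P x.
  by case/and4P=> ? ? ? _; case: x.
move=> /sub-/(_ (cmpz a)) /sub-/(_ (cmpz b)) /sub-/(_ (cmpz c)) /sub-/(_ (cmpz d)).
rewrite ok => h; apply: (all_extensions_sound (n := size fs) (k := 4)) => //.
by move: h; rewrite /sv /= take0 /ev /= !mul1r !mul0r !addr0 !add0r.
Qed.

Lemma locate_ev f : (f \in forms) || (oppf f \in forms) ->
  signed_sign sv (locate f) = cmpz (ev f).
Proof.
rewrite /signed_sign /locate; have [fi _|nfi /= fi] := boolP (f \in forms).
  by rewrite -[LHS]/(nth Eq sv (index f forms)) (nth_map formA) ?index_mem // nth_index.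
rewrite -[LHS]/(opp (nth Eq sv (index (oppf f) forms))).
by rewrite (nth_map formA) ?index_mem // nth_index // ev_oppf cmpzN; case: (cmpz _).
Qed.

Definition ev_signs (m : form_matrix) : signs :=
  let: (f, g, h, k) := m in signs_of (ev f) (ev g) (ev h) (ev k).

Lemma located_signs_ev m : covered m ->
  located_signs sv (map locate (forms_of m)) = ev_signs m.
Proof.
case: m => -[[f g] h] k /allP cov; rewrite /located_signs -map_comp.
rewrite (_ : map _ _ = [seq cmpz (ev f) | f <- forms_of (f, g, h, k)]).
  by rewrite /= !(ev_subf, ev_addf).
by apply/eq_in_map => e /cov; apply: locate_ev.
Qed.

Lemma check_identity_sound l r :
  check_identity l r -> sum_coef ev_signs l = sum_coef ev_signs r.
Proof.
have sumE s : all covered s ->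
    sum_coef (located_signs sv) (map (fun m => map locate (forms_of m)) s) =
    sum_coef ev_signs s.
  by elim: s => //= m s IH /andP[cm /IH ->]; rewrite located_signs_ev.
case/andP; rewrite all_cat => /andP[cl cr] /all_sign_vectors_sound /eqP.
by rewrite !sumE.
Qed.
End Soundness.
End Enumeration.

(** Collects, up to sign, the forms whose signs the coefficients need. The first four are dropped
    because the enumeration puts a, b, c, d in front itself. *)
Definition new_forms (l : seq form_matrix) : seq form :=
  drop 4 (foldl (fun s f => if (f \in s) || (oppf f \in s) then s else rcons s f)
    [:: formA; formB; formC; formD] (flatten [seq forms_of m | m <- l])).

Definition mulS_form (m : form_matrix) : form_matrix :=
  let: (a, b, c, d) := m in (b, oppf a, d, oppf c).
Definition mulU_form (m : form_matrix) : form_matrix :=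
  let: (a, b, c, d) := m in (addf a b, oppf a, addf c d, oppf c).
Definition Smul_form (m : form_matrix) : form_matrix :=
  let: (a, b, c, d) := m in (oppf c, oppf d, a, b).
Definition Umul_form (m : form_matrix) : form_matrix :=
  let: (a, b, c, d) := m in (subf a c, subf b d, a, b).

Definition generic : form_matrix := (formA, formB, formC, formD).

(** With M = [[a, b], [c, d]], the four terms belong to M, M S, U M and U M S: this is the
    invariance of T (1 + S) under U on the left. *)
Lemma coef_symS (a b c d : int) : 0 < a * d - b * c ->
  coef (signs_of a b c d) + coef (signs_of b (- a) d (- c)) =
  coef (signs_of (a - c) (b - d) a b) + coef (signs_of (b - d) (c - a) b (- a)).
Proof.
move=> D; pose l := [:: generic; mulS_form generic].
pose r := [:: Umul_form generic; mulS_form (Umul_form generic)].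
have ok : check_identity (new_forms (l ++ r)) l r by vm_compute.
have := check_identity_sound D ok; rewrite /= /ev /=.
rewrite !(mul1r, mulN1r, mul0r, oppr0, add0r, addr0, subr0, mul1n).
by rewrite [- a + c]addrC.
Qed.

(** The same for T (1 + U + U^2): the terms belong to M, M U, M U^2 on one side and to S M, S M U, S
    M U^2 on the other. *)
Lemma coef_symU (a b c d : int) : 0 < a * d - b * c ->
  coef (signs_of a b c d) + coef (signs_of (a + b) (- a) (c + d) (- c)) +
    coef (signs_of b (- (a + b)) d (- (c + d))) =
  coef (signs_of (- c) (- d) a b) + coef (signs_of (- c - d) c (a + b) (- a)) +
    coef (signs_of (- d) (c + d) b (- (a + b))).
Proof.
move=> D; pose l := [:: generic; mulU_form generic; mulU_form (mulU_form generic)].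
pose s := Smul_form generic; pose r := [:: s; mulU_form s; mulU_form (mulU_form s)].
have ok : check_identity (new_forms (l ++ r)) l r by vm_compute.
have := check_identity_sound D ok; rewrite /= /ev /=.
rewrite !(mul1r, mulN1r, mul0r, oppr0, add0r, addr0, subr0, mul1n).
by rewrite !opprD !addrA.
Qed.

(** * The angle subtended by the fundamental domain *)

Section Angle.
Context {R : realType}.
Implicit Types x y t s al be ga : R.

Definition cmpR x : comparison := if x < 0 then Lt else if x == 0 then Eq else Gt.

Lemma fundFE x y : fundF (x +i* y)%C <->
  [/\ 0 < y, 0 <= x <= 1 / 2 & 1 <= (x - 1) ^+ 2 + y ^+ 2].
Proof.
have e : (1 <= `|(x +i* y)%C - 1|) = (1 <= (x - 1) ^+ 2 + y ^+ 2).
  rewrite normc_def (_ : 1 = (1 : R)%:C)%C // lecR /= subr0.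
  rewrite -[X in X <= _]sqrtr1 ler_sqrt //.
  by rewrite addr_ge0 ?sqr_ge0.
by rewrite /fundF /= e.
Qed.

(** Just to the right of 0 the first nonzero coefficient decides the sign, and the quadratic one
    cannot hurt. *)
Lemma near_quadratic al be ga : 0 <= ga ->
  (\forall s \near 0^'+, 0 <= al + s * be + s ^+ 2 * ga) <->
  0 < al \/ al = 0 /\ 0 <= be.
Proof.
move=> ga0; have nb := normr_ge0 be; have leb := ler_norm be.
have lebN : - be <= `|be| by rewrite -normrN ler_norm.
split=> [H|[al0|[-> be0]]]; last first.
- near=> s; have s0 : 0 < s by near: s; exact: nbhs_right_gt.
  by rewrite add0r addr_ge0 // mulr_ge0 ?sqr_ge0 // ltW.
- near=> s; have s0 : 0 < s by near: s; exact: nbhs_right_gt.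
  have : s < al / (`|be| + 1) by near: s; apply: nbhs_right_lt; apply: divr_gt0; lra.
  rewrite ltr_pdivlMr; last lra.
  move=> sl; have : 0 <= s ^+ 2 * ga by rewrite mulr_ge0 ?sqr_ge0.
  nra.
- have [al0|al0|al0] := ltgtP al 0; [|by left|].
  + exfalso; near (0 : R)^'+ => s.
    have s0 : 0 < s by near: s; exact: nbhs_right_gt.
    have s1 : s < 1 by near: s; exact: nbhs_right_lt.
    (* For such s < 1 the linear and quadratic terms together stay below -al. *)
    have : s < - al / (`|be| + ga + 1).
      by near: s; apply: nbhs_right_lt; apply: divr_gt0; lra.
    rewrite ltr_pdivlMr; last lra.
    have : 0 <= al + s * be + s ^+ 2 * ga by near: s.
    have : s ^+ 2 * ga <= s * ga by rewrite expr2 ler_wpM2r // ler_piMl // ltW.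
    nra.
  + right; split=> //; rewrite leNgt; apply/negP => be0; near (0 : R)^'+ => s.
    have s0 : 0 < s by near: s; exact: nbhs_right_gt.
    have : s < - be / (ga + 1).
      by near: s; apply: nbhs_right_lt; apply: divr_gt0; lra.
    rewrite ltr_pdivlMr; last lra.
    have : 0 <= al + s * be + s ^+ 2 * ga by near: s.
    rewrite al0 add0r; nra.
Unshelve. all: by end_near. Qed.

(** Along a ray each closed condition is a polynomial in s whose s^2 coefficient is 0 or 1, so its
    value and derivative at 0 decide. The condition y > 0 is open and restricts no direction. *)
Lemma directionsE x y : 0 < y ->
  directions (x +i* y)%C = [set t | [/\ 0 <= t < 2 * pi,
    0 < x \/ x = 0 /\ 0 <= cos t,
    0 < 1 / 2 - x \/ 1 / 2 - x = 0 /\ 0 <= - cos t &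
    0 < (x - 1) ^+ 2 + y ^+ 2 - 1 \/ (x - 1) ^+ 2 + y ^+ 2 - 1 = 0 /\
      0 <= (x - 1) * cos t + y * sin t] ].
Proof.
move=> y0; apply/seteqP; split=> t /=.
  move=> [tI F].
  have {}F : \forall s \near 0^'+, [/\ 0 < y + s * sin t,
      0 <= x + s * cos t <= 1 / 2 & 1 <= (x + s * cos t - 1) ^+ 2 + (y + s * sin t) ^+ 2].
    by apply: filterS F => s /fundFE.
  split=> //.
  - apply/(near_quadratic x (cos t) (lexx 0)).
    by apply: filterS F => s [_ /andP[? _] _]; rewrite mulr0 addr0.
  - apply/(near_quadratic (1 / 2 - x) (- cos t) (lexx 0)).
    apply: filterS F => s [_ /andP[_ ?] _]; rewrite mulr0 addr0; nra.
  - have := near_quadratic ((x - 1) ^+ 2 + y ^+ 2 - 1)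
      (2 * ((x - 1) * cos t + y * sin t)) (ler01 : 0 <= 1 :> R).
    rewrite pmulr_rge0 // => <-.
    apply: filterS F => s [_ _]; have := cos2Dsin2 t; nra.
move=> [tI P1 P2 P3]; split=> //.
have {}P1 := (near_quadratic x (cos t) (lexx 0)).2 P1.
have {}P2 := (near_quadratic (1 / 2 - x) (- cos t) (lexx 0)).2 P2.
have P4 := (near_quadratic y (sin t) (lexx 0)).2 (or_introl y0).
have {}P3 : \forall s \near 0^'+, 0 <= (x - 1) ^+ 2 + y ^+ 2 - 1 +
    s * (2 * ((x - 1) * cos t + y * sin t)) + s ^+ 2 * 1.
  by apply/near_quadratic => //; rewrite pmulr_rge0.
near=> s; apply/fundFE; split.
- have s0 : 0 < s by near: s; exact: nbhs_right_gt.
  have : s < y by near: s; exact: nbhs_right_lt.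
  have := sin_geN1 t. nra.
- have : 0 <= x + s * cos t + s ^+ 2 * 0 by near: s.
  have : 0 <= 1 / 2 - x + s * - cos t + s ^+ 2 * 0 by near: s.
  lra.
- have : 0 <= (x - 1) ^+ 2 + y ^+ 2 - 1 +
    s * (2 * ((x - 1) * cos t + y * sin t)) + s ^+ 2 * 1 by near: s.
  have := cos2Dsin2 t; nra.
Unshelve. all: by end_near. Qed.

Lemma cos_ge0E t : - (3 * pi / 2) < t < 3 * pi / 2 ->
  (0 <= cos t) = (- (pi / 2) <= t <= pi / 2).
Proof.
move=> tI; have pi0 := pi_gt0 R.
apply/idP/idP; last exact: cos_ge0_pihalf.
apply: contraTT; rewrite negb_and -!ltNge => /orP[h|h].
  rewrite -oppr_gt0 -cosDpi; apply: cos_gt0_pihalf; lra.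
rewrite -oppr_gt0 -[t](subrK pi) cosDpi opprK; apply: cos_gt0_pihalf; lra.
Qed.

Lemma cos_half_turn t : 0 <= t < 2 * pi ->
  (0 <= - cos t) = (pi / 2 <= t <= 3 * pi / 2).
Proof.
move=> tI; have pi0 := pi_gt0 R.
rewrite -{1}[t](subrK pi) cosDpi opprK cos_ge0E; last lra.
by apply/idP/idP; lra.
Qed.

Lemma cos_right_half t : 0 <= t < 2 * pi ->
  (0 <= cos t) = (t <= pi / 2) || (3 * pi / 2 <= t).
Proof.
move=> tI; have pi0 := pi_gt0 R; apply/idP/idP.
  apply: contraTT; rewrite negb_or -!ltNge => h.
  rewrite -oppr_gt0 -[t](subrK pi) cosDpi opprK; apply: cos_gt0_pihalf; lra.
case/orP=> h; first by apply: cos_ge0_pihalf; lra.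
rewrite -[t](subrK (pi *+ 2)) cosD2pi; apply: cos_ge0_pihalf; lra.
Qed.

Lemma measure_cc a b : a <= b -> lebesgue_measure (`[a, b]%classic : set R) = (b - a)%:E.
Proof.
move=> ab; rewrite lebesgue_measure_itv /= lte_fin EFinB.
by case: ltP => // ba; rewrite (le_anti (introT andP (conj ab ba))) subee.
Qed.

Lemma measure_co a b : a <= b -> lebesgue_measure (`[a, b[%classic : set R) = (b - a)%:E.
Proof.
move=> ab; rewrite lebesgue_measure_itv /= lte_fin EFinB.
by case: ltP => // ba; rewrite (le_anti (introT andP (conj ab ba))) subee.
Qed.

Lemma chi_val x y (r : R) : lebesgue_measure (directions (x +i* y)%C) = r%:E ->
  chi (x +i* y)%C = r / (2 * pi).
Proof. by rewrite /chi => ->. Qed.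

Lemma acos_obtuse x : -1 <= x <= 0 -> pi / 2 <= acos x <= pi.
Proof.
move=> xI; have pi0 := pi_gt0 R; have xI' : -1 <= x <= 1 by lra.
rewrite (acos_lepi xI') andbT leNgt; apply/negP => h.
have := acosK (x := x); rewrite in_itv /= xI' => /(_ isT).
have : 0 < cos (acos x).
  by apply: cos_gt0_pihalf; have := acos_ge0 xI'; lra.
lra.
Qed.

(** On the circle, x - 1 and y are the cosine and sine of some angle th, and the expression is cos
    (t - th). Since x < 1, th lies in [pi/2, pi], so the half turn around th does not wrap past 0 or
    2 pi. *)
Lemma circle_half_turn x y t : x < 1 -> 0 < y -> (x - 1) ^+ 2 + y ^+ 2 - 1 = 0 ->
  0 <= t < 2 * pi ->
  (0 <= (x - 1) * cos t + y * sin t) =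
  (acos (x - 1) - pi / 2 <= t <= acos (x - 1) + pi / 2).
Proof.
move=> x1 y0 xy tI; have pi0 := pi_gt0 R.
have xI : -1 <= x - 1 <= 0 by apply/andP; split; nra.
have xI' : -1 <= x - 1 <= 1 by lra.
have aI := acos_obtuse xI.
have ca : cos (acos (x - 1)) = x - 1 by apply: acosK; rewrite in_itv.
have sa : sin (acos (x - 1)) = y.
  rewrite sin_acos // (_ : 1 - (x - 1) ^+ 2 = y ^+ 2); last by move: xy; nra.
  by rewrite sqrtr_sqr gtr0_norm.
rewrite -{1}ca -{1}sa mulrC [sin _ * _]mulrC -cosB cos_ge0E; last lra.
by apply/idP/idP; lra.
Qed.

Lemma acos_Nhalf : acos (- (1 / 2)) = 2 * pi / 3 :> R.
Proof.
have pi0 := pi_gt0 R.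
have c0 : 0 < cos (pi / 3) :> R by apply: cos_gt0_pihalf; lra.
have c3 : cos (pi / 3 *+ 3) = -1 :> R by rewrite -cospi; congr cos; lra.
have : cos (pi / 3) = 1 / 2 :> R.
  move: c3; rewrite mulrS cosD cos_mulr2n sin_mulr2n.
  have := cos2Dsin2 (pi / 3 : R); set c := cos _; set s := sin _ => h1 h2.
  (* The triple angle formula at pi/3 reads 4 c^3 - 3 c = -1, and 4 c^3 - 3 c + 1 factors as (c + 1)
     (2 c - 1)^2; positivity of c then leaves 1/2. *)
  have : (c + 1) * (2 * c - 1) ^+ 2 = 0.
    have h3 : c * (c ^+ 2 * 2 - 1) - s * (c * s * 2) = -1 by apply: etrans h2; ring.
    have -> : (c + 1) * (2 * c - 1) ^+ 2 = (c * (c ^+ 2 * 2 - 1) - s * (c * s * 2)) + 1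
      + 2 * c * (c ^+ 2 + s ^+ 2 - 1) by ring.
    by rewrite h1 h3; ring.
  move/eqP; rewrite mulf_eq0 sqrf_eq0; rewrite -/c in c0.
  by case/orP=> /eqP; lra.
move=> ch; have : cos (2 * pi / 3) = - (1 / 2) :> R.
  rewrite -ch -[in RHS]cosN -cosDpi; congr cos; lra.
by move=> <-; apply: cosK; rewrite in_itv /=; lra.
Qed.

(** The directions with nonnegative cosine: cutting the circle at angle 0 splits this half turn into
    two intervals. *)
Lemma measure_right_half : lebesgue_measure
  (`[0, pi / 2] `|` `[3 * pi / 2, 2 * pi[ : set R)%classic = pi%:E.
Proof.
have pi0 := pi_gt0 R.
rewrite measureU //; last first.
  by apply/seteqP; split=> t //= []; rewrite !in_itv /=; lra.
rewrite [X in (X + _)%E]measure_cc; last lra.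
by rewrite [X in (_ + X)%E]measure_co; [rewrite -EFinD; congr EFin; lra|lra].
Qed.

(** A point outside sees nothing, an interior point sees the full turn and a point on one edge sees
    a half turn; only at e^(i pi/3) do two edges meet. *)
Lemma chiE x y : 0 < y -> chi (x +i* y)%C =
  (wt3 (cmpR x) (cmpR (1 / 2 - x)) (cmpR ((x - 1) ^+ 2 + y ^+ 2 - 1)))%:~R / 12.
Proof.
move=> y0; have pi0 := pi_gt0 R; have D := directionsE x y0.
set q := (x - 1) ^+ 2 + y ^+ 2 - 1 in D *.
have outside : x < 0 \/ 1 / 2 - x < 0 \/ q < 0 -> chi (x +i* y)%C = 0.
  move=> H; rewrite (chi_val (r := 0)) ?mul0r // D.
  rewrite (_ : [set _ | _] = set0) ?measure0 //.
  by apply/seteqP; split=> t //= -[_]; lra.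
rewrite /cmpR; case: ltP => [x0|x0]; first by rewrite outside ?mul0r //; left.
case: (ltP (1 / 2 - x) 0) => [x1|x1].
  rewrite outside; last by right; left.
  by case: eqP; rewrite /= mul0r.
case: (ltP q 0) => [q0|q0].
  rewrite outside; last by right; right.
  by case: eqP; case: eqP; rewrite /= mul0r.
have turn (p : R) : p != 0 -> [/\ p / (2 * p) = 6 / 12,
    (2 * p / 3) / (2 * p) = 4 / 12 & (2 * p) / (2 * p) = 12 / 12].
  by move=> p0; split; field; rewrite p0.
have [e1 e2 e3] := turn pi (negbT (gt_eqF pi0)).
have half (A : set R) : directions (x +i* y)%C = A -> lebesgue_measure A = pi%:E ->
    chi (x +i* y)%C = 6%:~R / 12.
  by move=> DA mA; rewrite (chi_val (r := pi)) ?DA.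
have [x0'|x0'] := eqVneq x 0.
  (* The edge Re z = 0 stays off the circle: there q = y^2. *)
  have q0' : 0 < q by rewrite /q x0'; nra.
  rewrite (gt_eqF q0') x0' (_ : 1 / 2 - 0 == 0 = false) /=; last by apply/eqP; lra.
  rewrite -x0'; apply: half measure_right_half; rewrite D.
  apply/seteqP; split=> t /=; rewrite !in_itv /=.
    move=> [tI P1 _ _]; case: P1 => [|[_]]; first lra.
    by rewrite cos_right_half // => /orP[?|?]; [left|right]; lra.
  have tI : (0 <= t <= pi / 2) \/ (3 * pi / 2 <= t < 2 * pi) -> 0 <= t < 2 * pi by case; lra.
  move=> tU; split; first exact: tI; last by left.
    right; rewrite cos_right_half ?tI //; split=> //.
    by case: tU => /andP[? ?]; apply/orP; [left|right].
  by left; rewrite x0'; lra.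
have x0p : 0 < x by rewrite lt_neqAle eq_sym x0'.
have qp : q != 0 -> 0 < q by rewrite [0 < q]lt_neqAle eq_sym q0 andbT.
have x1p : 1 / 2 - x != 0 -> 0 < 1 / 2 - x by rewrite [0 < _ - x]lt_neqAle eq_sym x1 andbT.
have acosI : x - 1 < 0 -> q = 0 -> pi / 2 <= acos (x - 1) <= pi.
  by move=> ? ?; apply: acos_obtuse; apply/andP; split; last lra; rewrite /q in q0 *; nra.
have [x1'|x1'] := eqVneq (1 / 2 - x) 0; have [q0'|q0'] := eqVneq q 0 => /=.
- have x2 : x - 1 = - (1 / 2) by lra.
  rewrite (chi_val (r := 2 * pi / 3)) //.
  (* The half turns [pi/2, 3 pi/2] and [pi/6, 7 pi/6] of the two edges overlap in an angle 2
     pi/3. *)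
  rewrite D (_ : [set _ | _] = `[pi / 2, 7 * pi / 6]%classic).
    by rewrite measure_cc; [congr EFin; lra|lra].
  apply/seteqP; split=> t /=; rewrite in_itv /=.
    move=> [tI _ [|[_]] P2 [|[_]]]; [lra|lra|lra|].
    move: P2; rewrite cos_half_turn // circle_half_turn //; last lra.
    by rewrite x2 acos_Nhalf; lra.
  move=> tI'; have tI : 0 <= t < 2 * pi by lra.
  split=> //; [by left|right; split=> //|right; split=> //].
    by rewrite cos_half_turn //; lra.
  by rewrite circle_half_turn //; [rewrite x2 acos_Nhalf; lra|lra].
- apply: (half `[pi / 2, 3 * pi / 2]%classic).
    rewrite D; apply/seteqP; split=> t /=; rewrite in_itv /=.
      move=> [tI _ [|[_]] P2 _]; first lra.
      by move: P2; rewrite cos_half_turn.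
    move=> tI'; have tI : 0 <= t < 2 * pi by lra.
    by split=> //; [left|right; rewrite cos_half_turn|left; exact: qp].
  by rewrite measure_cc; [congr EFin; lra|lra].
- have aI : pi / 2 <= acos (x - 1) <= pi by apply: acosI => //; lra.
  apply: (half `[acos (x - 1) - pi / 2, acos (x - 1) + pi / 2]%classic).
    rewrite D; apply/seteqP; split=> t /=; rewrite in_itv /=.
      move=> [tI _ _ [|[_]]]; first lra.
      by rewrite circle_half_turn //; lra.
    move=> tI'; have tI : 0 <= t < 2 * pi by lra.
    split=> //; [by left|by left; exact: x1p|right; split=> //].
    by rewrite circle_half_turn //; lra.
  by rewrite measure_cc; [congr EFin; lra|lra].
- rewrite (chi_val (r := 2 * pi)) //.
  rewrite D (_ : [set _ | _] = `[0, 2 * pi[%classic); first by rewrite measure_co ?subr0 //; lra.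
  apply/seteqP; split=> t /=; rewrite in_itv /=; first by case.
  by move=> tI; split=> //; left; [|exact: x1p|exact: qp].
Qed.
End Angle.

(** * Formal products *)

Lemma mx2E (a b c d : int) :
  (mx2 a b c d 0 0 = a) * (mx2 a b c d 0 1 = b) *
  (mx2 a b c d 1 0 = c) * (mx2 a b c d 1 1 = d).
Proof. by rewrite /mx2 !mxE. Qed.

Lemma ord2_cases (i : 'I_2) : i = 0 \/ i = 1.
Proof. by case: i => -[|[|//]] ?; [left|right]; apply: val_inj. Qed.

Lemma mx2_eta (A : 'M[int]_2) : A = mx2 (A 0 0) (A 0 1) (A 1 0) (A 1 1).
Proof.
by apply/matrixP=> i j; case: (ord2_cases i) => ->; case: (ord2_cases j) => ->;
  rewrite mx2E.
Qed.

Lemma det_mx2 (a b c d : int) : \det (mx2 a b c d) = a * d - b * c.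
Proof. by rewrite det2 !mx2E. Qed.

Lemma pm2_eq (a b c d a' b' c' d' : int) : a = a' -> b = b' -> c = c' -> d = d' ->
  pm (mx2 a b c d) = pm (mx2 a' b' c' d').
Proof. by move=> -> -> -> ->. Qed.

Lemma mul_mx2 (a b c d e f g h : int) :
  mx2 a b c d *m mx2 e f g h =
  mx2 (a * e + b * g) (a * f + b * h) (c * e + d * g) (c * f + d * h).
Proof.
have E : lift 0 0 = 1 :> 'I_2 by apply/val_inj.
by apply/matrixP=> i j; case: (ord2_cases i) => ->; case: (ord2_cases j) => ->;
  rewrite mx2E mxE !big_ord_recl big_ord0 addr0 E !mx2E.
Qed.

Lemma opp_mx2 (a b c d : int) : - mx2 a b c d = mx2 (- a) (- b) (- c) (- d).
Proof.
by apply/matrixP=> i j; case: (ord2_cases i) => ->; case: (ord2_cases j) => ->;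
  rewrite mxE !mx2E.
Qed.

Lemma det2N (A : 'M[int]_2) : \det (- A) = \det A.
Proof. by rewrite !det2 !mxE !mulrNN. Qed.

Lemma det_rep_gt0 (M : matpm) : 0 < \det (rep M).
Proof. by case/andP: (matpmP M). Qed.

Lemma det_rep_pm (A : 'M[int]_2) : 0 < \det A -> \det (rep (pm A)) = \det A.
Proof. by move=> dA; rewrite rep_pm //; case: ifP; rewrite ?det2N. Qed.

Lemma pmN (A : 'M[int]_2) : 0 < \det A -> pm (- A) = pm A.
Proof. by move=> dA; apply/eq_pm; rewrite ?det2N //; right. Qed.

Lemma Mmul_pm (A B : 'M[int]_2) : 0 < \det A -> 0 < \det B ->
  Mmul (pm A) (pm B) = pm (A *m B).
Proof.
move=> dA dB; have dAB : 0 < \det (A *m B) by rewrite det_mulmx mulr_gt0.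
rewrite /Mmul !rep_pm //.
by case: ifP => _; case: ifP => _; rewrite ?mulNmx ?mulmxN ?opprK ?pmN.
Qed.

Lemma det_Mmul (M N : matpm) :
  \det (rep (Mmul M N)) = \det (rep M) * \det (rep N).
Proof. by rewrite /Mmul det_rep_pm det_mulmx ?mulr_gt0 ?det_rep_gt0. Qed.

Lemma MmulA (M N P : matpm) : Mmul M (Mmul N P) = Mmul (Mmul M N) P.
Proof.
have dM := det_rep_gt0 M; have dN := det_rep_gt0 N; have dP := det_rep_gt0 P.
by rewrite -(repK M) -(repK N) -(repK P) !Mmul_pm ?det_mulmx ?mulr_gt0 // mulmxA.
Qed.

Lemma Mone_pm : Mone = pm 1%:M.
Proof. by rewrite -(repK Mone). Qed.

Lemma Mmul1M (M : matpm) : Mmul Mone M = M.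
Proof. by rewrite /Mmul /= mul1mx repK. Qed.

Lemma MmulM1 (M : matpm) : Mmul M Mone = M.
Proof. by rewrite /Mmul /= mulmx1 repK. Qed.

Lemma Mmul_pm2 (a b c d e f g h : int) :
  0 < a * d - b * c -> 0 < e * h - f * g ->
  Mmul (pm (mx2 a b c d)) (pm (mx2 e f g h)) =
  pm (mx2 (a * e + b * g) (a * f + b * h) (c * e + d * g) (c * f + d * h)).
Proof. by move=> ? ?; rewrite Mmul_pm ?det_mx2 // mul_mx2. Qed.

Lemma mx2_1 : 1%:M = mx2 1 0 0 1.
Proof.
by apply/matrixP=> i j; case: (ord2_cases i) => ->; case: (ord2_cases j) => ->;
  rewrite mx2E mxE.
Qed.

Lemma SS : Mmul Smat Smat = Mone.
Proof. by rewrite Mmul_pm2 // Mone_pm mx2_1 -pmN ?opp_mx2 ?det_mx2. Qed.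

Lemma UUE : Mmul Umat Umat = pm (mx2 0 (-1) 1 (-1)).
Proof. by rewrite Mmul_pm2. Qed.

Lemma UUU : Mmul Umat (Mmul Umat Umat) = Mone.
Proof. by rewrite UUE Mmul_pm2 // Mone_pm mx2_1 -pmN ?opp_mx2 ?det_mx2. Qed.

Lemma Mone_neq_S : Mone != Smat.
Proof.
apply/eqP => /(congr1 (fun M => rep M 1 0)); rewrite /Smat rep_pm ?det_mx2 //.
by rewrite /pos_rep !mx2E /= mxE.
Qed.

Lemma U_facts : [/\ Mone != Umat, Mone != Mmul Umat Umat & Umat != Mmul Umat Umat].
Proof.
rewrite UUE; split; apply/eqP.
- move=> /(congr1 (fun M => rep M 1 0)); rewrite /Umat rep_pm ?det_mx2 //.
  by rewrite /pos_rep !mx2E /= mxE.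
- move=> /(congr1 (fun M => rep M 1 0)); rewrite rep_pm ?det_mx2 //.
  by rewrite /pos_rep !mx2E /= mxE.
- move=> /(congr1 (fun M => rep M 0 0)); rewrite /Umat !rep_pm ?det_mx2 //.
  by rewrite /pos_rep !mx2E /= .
Qed.

Section FormalProduct.
Context {R : realType}.
Implicit Types (xi eta : formal R) (s : seq matpm) (inv : matpm -> matpm).

(** As the elements A of [s] are invertible, A B = N determines B, and the sum over factorisations
    becomes a sum over [s]. *)
Lemma fmul_suppl s inv xi eta N : uniq s ->
  {in s, forall A, Mmul A (inv A) = Mone /\ Mmul (inv A) A = Mone} ->
  (forall A, A \notin s -> xi A = 0) ->
  fmul xi eta N = \sum_(A <- s) xi A * eta (Mmul (inv A) N).
Proof.
move=> us invs xi0; rewrite /fmul.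
rewrite (fsbigE [seq (A, Mmul (inv A) N) | A <- s]).
- rewrite big_map /= big_seq_cond [RHS]big_seq_cond; apply: eq_bigl => A.
  rewrite andbT; case sA : (A \in s) => //=; apply/mem_set => /=.
  by rewrite MmulA (invs _ sA).1 Mmul1M.
- by rewrite map_inj_uniq // => A B [].
- by move=> _ /= /mapP[A sA ->] /=; rewrite MmulA (invs _ sA).1 Mmul1M.
- move=> [A B] /= <- nAB; case sA : (A \in s); last by rewrite xi0 ?sA // mul0r.
  case/negP: nAB; apply/mapP; exists A => //.
  by rewrite MmulA (invs _ sA).2 Mmul1M.
Qed.

Lemma fmul_suppr s inv xi eta N : uniq s ->
  {in s, forall A, Mmul A (inv A) = Mone /\ Mmul (inv A) A = Mone} ->
  (forall A, A \notin s -> eta A = 0) ->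
  fmul xi eta N = \sum_(A <- s) xi (Mmul N (inv A)) * eta A.
Proof.
move=> us invs xi0; rewrite /fmul.
rewrite (fsbigE [seq (Mmul N (inv A), A) | A <- s]).
- rewrite big_map /= big_seq_cond [RHS]big_seq_cond; apply: eq_bigl => A.
  rewrite andbT; case sA : (A \in s) => //=; apply/mem_set => /=.
  by rewrite -MmulA (invs _ sA).2 MmulM1.
- by rewrite map_inj_uniq // => A B [].
- by move=> _ /= /mapP[A sA ->] /=; rewrite -MmulA (invs _ sA).2 MmulM1.
- move=> [A B] /= <- nAB; case sA : (B \in s); last by rewrite xi0 ?sA // mulr0.
  case/negP: nAB; apply/mapP; exists B => //.
  by rewrite -MmulA (invs _ sA).1 MmulM1.
Qed.

(** Inverses on {1, S} and on {1, U, U^2}: elements of the first set have square 1, those of the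
    second have cube 1. *)
Definition Sinv (M : matpm) := M.
Definition Uinv (M : matpm) := Mmul M M.
Lemma Uinv_U2 : Uinv (Mmul Umat Umat) = Umat.
Proof. by rewrite /Uinv -MmulA UUU MmulM1. Qed.
Lemma Uinv_1 : Uinv Mone = Mone. Proof. by rewrite /Uinv MmulM1. Qed.

Lemma S_inv : {in [:: Mone; Smat], forall A, Mmul A (Sinv A) = Mone /\ Mmul (Sinv A) A = Mone}.
Proof. by move=> A; rewrite !inE => /orP[]/eqP->; rewrite /Sinv ?MmulM1 ?SS. Qed.

Lemma U_inv : {in [:: Mone; Umat; Mmul Umat Umat],
  forall A, Mmul A (Uinv A) = Mone /\ Mmul (Uinv A) A = Mone}.
Proof.
move=> A; rewrite !inE => /or3P[]/eqP->; rewrite ?Uinv_1 ?Uinv_U2 ?MmulM1 //.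
  by rewrite /Uinv -MmulA UUU.
by rewrite -MmulA UUU.
Qed.

Lemma uniq_S : uniq [:: Mone; Smat].
Proof. by rewrite /= inE Mone_neq_S. Qed.
Lemma uniq_U : uniq [:: Mone; Umat; Mmul Umat Umat].
Proof. by case: U_facts => h1 h2 h3; rewrite /= !inE negb_or h1 h2 h3. Qed.

Lemma fmul_scaler xi eta (k : R) :
  fmul xi (fun M => eta M / k) = (fun N => fmul xi eta N / k).
Proof.
apply/funext => N; rewrite /fmul mulr_fsuml; apply: eq_fsbigr => p _.
by rewrite mulrA.
Qed.

Lemma fmul_scalel xi eta (k : R) :
  fmul (fun M => xi M / k) eta = (fun N => fmul xi eta N / k).
Proof.
apply/funext => N; rewrite /fmul mulr_fsuml; apply: eq_fsbigr => p _.
by rewrite mulrAC.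
Qed.

Lemma oneS_notin A : A \notin [:: Mone; Smat] -> (fone + fS : formal R) A = 0.
Proof.
by rewrite !inE negb_or => /andP[/negbTE h1 /negbTE h2];
  rewrite /fone /fS /single fctE h1 h2 addr0.
Qed.

Lemma oneU_notin A : A \notin [:: Mone; Umat; Mmul Umat Umat] ->
  (fone + fU + fU2 : formal R) A = 0.
Proof.
by rewrite !inE !negb_or => /and3P[/negbTE h1 /negbTE h2 /negbTE h3];
  rewrite /fone /fU /fU2 /single !fctE h1 h2 h3 !addr0.
Qed.

Lemma oneSE : ((fone + fS : formal R) Mone = 1) * ((fone + fS : formal R) Smat = 1).
Proof.
rewrite /fone /fS /single !fctE !eqxx [Smat == Mone]eq_sym (negbTE Mone_neq_S).
by rewrite addr0 add0r.
Qed.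

Lemma oneUE : ((fone + fU + fU2 : formal R) Mone = 1) *
  ((fone + fU + fU2 : formal R) Umat = 1) *
  ((fone + fU + fU2 : formal R) (Mmul Umat Umat) = 1).
Proof.
case: U_facts => /negbTE h1 /negbTE h2 /negbTE h3.
rewrite /fone /fU /fU2 /single !fctE !eqxx h1 h2 h3.
rewrite [Umat == Mone]eq_sym [Mmul Umat Umat == Umat]eq_sym.
by rewrite [Mmul Umat Umat == Mone]eq_sym h1 h2 h3 !(addr0, add0r).
Qed.

Lemma fmul_oneS_r xi N : fmul xi (fone + fS) N = xi N + xi (Mmul N Smat).
Proof.
rewrite (fmul_suppr _ _ uniq_S S_inv) ?big_cons ?big_nil ?oneSE; last exact: oneS_notin.
by rewrite /Sinv MmulM1 !mulr1 addr0.
Qed.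

Lemma fmul_oneS_l xi N : fmul (fone + fS) xi N = xi N + xi (Mmul Smat N).
Proof.
rewrite (fmul_suppl _ _ uniq_S S_inv) ?big_cons ?big_nil ?oneSE; last exact: oneS_notin.
by rewrite /Sinv Mmul1M !mul1r addr0.
Qed.

Lemma fmul_oneU_r xi N : fmul xi (fone + fU + fU2) N =
  xi N + xi (Mmul N Umat) + xi (Mmul N (Mmul Umat Umat)).
Proof.
rewrite (fmul_suppr _ _ uniq_U U_inv) ?big_cons ?big_nil ?oneUE; last exact: oneU_notin.
by rewrite Uinv_1 Uinv_U2 MmulM1 !mulr1 addr0 [xi (Mmul N (Uinv _)) + _]addrC addrA.
Qed.

Lemma fmul_oneU_l xi N : fmul (fone + fU + fU2) xi N =
  xi N + xi (Mmul Umat N) + xi (Mmul (Mmul Umat Umat) N).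
Proof.
rewrite (fmul_suppl _ _ uniq_U U_inv) ?big_cons ?big_nil ?oneUE; last exact: oneU_notin.
by rewrite Uinv_1 Uinv_U2 Mmul1M !mul1r addr0 [xi (Mmul (Uinv _) N) + _]addrC addrA.
Qed.

Lemma fmul_singlel A B xi N : Mmul A B = Mone -> Mmul B A = Mone ->
  fmul (single A) xi N = xi (Mmul B N).
Proof.
move=> AB BA; rewrite (@fmul_suppl [:: A] (fun=> B)) //.
- by rewrite big_seq1 /single eqxx mul1r.
- by move=> C; rewrite inE => /eqP ->.
- by move=> C; rewrite inE /single => /negbTE ->.
Qed.

Lemma fmul_singler A B xi N : Mmul A B = Mone -> Mmul B A = Mone ->
  fmul xi (single A) N = xi (Mmul N B).
Proof.
move=> AB BA; rewrite (@fmul_suppr [:: A] (fun=> B)) //.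
- by rewrite big_seq1 /single eqxx mulr1.
- by move=> C; rewrite inE => /eqP ->.
- by move=> C; rewrite inE /single => /negbTE ->.
Qed.

Lemma SxiS xi N : fmul (fmul fS xi) fS N = xi (Mmul Smat (Mmul N Smat)).
Proof. by rewrite (@fmul_singler _ Smat) ?SS // (@fmul_singlel _ Smat) ?SS. Qed.

Lemma U2xiU xi N :
  fmul (fmul fU2 xi) fU N = xi (Mmul Umat (Mmul N (Mmul Umat Umat))).
Proof.
rewrite (@fmul_singler _ (Mmul Umat Umat)) ?UUU //; last by rewrite -MmulA UUU.
by rewrite (@fmul_singlel _ Umat) ?UUU // -MmulA UUU.
Qed.

Lemma TtildeE N : Ttilde R N =
  - fE N + fH N + fX N - fX (Mmul Smat (Mmul N Smat))
  + fY N - fY (Mmul Umat (Mmul N (Mmul Umat Umat)))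
  + fZ N - fZ (Mmul Umat (Mmul N (Mmul Umat Umat))).
Proof. by rewrite /Ttilde !fctE SxiS !U2xiU. Qed.
End FormalProduct.

(** * The coefficients of the element *)

Lemma isgt_cmpz x : isgt (cmpz x) = (0 < x).
Proof. by case: (cmpzP x) => /=; lia. Qed.
Lemma islt_cmpz x : islt (cmpz x) = (x < 0).
Proof. by case: (cmpzP x) => /=; lia. Qed.
Lemma iseq_cmpz x : iseq (cmpz x) = (x == 0).
Proof. by case: (cmpzP x) => /=; lia. Qed.

Definition normal4 (a c : int) := (0 < c) || (c == 0) && (0 < a).

Lemma pos_rep_mx2 (a b c d : int) : pos_rep (mx2 a b c d) = normal4 a c.
Proof. by rewrite /pos_rep !mx2E. Qed.

Lemma normal_signs_of a b c d : normal (signs_of a b c d) = normal4 a c.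
Proof. by rewrite /normal /= !isgt_cmpz iseq_cmpz. Qed.

Lemma divr_eq_mulr (F : fieldType) (p q w : F) : q != 0 -> (p / q = w <-> p = w * q).
Proof. by move=> q0; split=> [<-|->]; rewrite ?divfK ?mulfK. Qed.

Lemma mobius_den_neq0 (R : realType) (u v c d : R) : c != 0 -> 0 < v ->
  c%:C%C * (u +i* v)%C + d%:C%C != 0.
Proof.
move=> c0 v0; apply/eqP => -[_ /eqP].
by rewrite mul0r addr0 addr0 mulf_eq0 (negbTE c0) gt_eqF.
Qed.

Section Coefficients.
Context {R : realType}.

Lemma weight2E (w : int) (A B C D : int) :
  weight2 (w%:~R / 12 : R) A B C D = (wt w (cmpz (B - A)) (cmpz (D - C)))%:~R / 12.
Proof.
rewrite /weight2; case: (cmpzP (B - A)) => hAB; case: (cmpzP (D - C)) => hCD /=;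
  repeat case: ifP => //=; rewrite ?mul0r //; try lia; move=> *; lra.
Qed.

Lemma nestedE (A B C : int) :
  nested A B C = (wt 2 (cmpz (B - A)) (cmpz (C - B)))%:~R / 12 :> R.
Proof. by rewrite -weight2E /nested; congr weight2; lra. Qed.

Lemma independentE (A B C D : int) :
  independent A B C D = (wt 3 (cmpz (B - A)) (cmpz (D - C)))%:~R / 12 :> R.
Proof. by rewrite -weight2E /independent; congr weight2; lra. Qed.

Lemma bracketE L1 L2 (a b c d : int) : 0 < a * d - b * c -> normal4 a c ->
  bracket (R := R) L1 L2 (pm (mx2 a b c d)) = if L2 a b c d then L1 a b c d else 0.
Proof.
by move=> dA nA; rewrite /bracket rep_pm ?det_mx2 // pos_rep_mx2 nA !mx2E.
Qed.

Lemma cmpR_scale (k : R) (n : int) : 0 < k -> cmpR (n%:~R * k) = cmpz n.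
Proof.
move=> k0; rewrite /cmpR pmulr_llt0 // mulf_eq0 (gt_eqF k0) orbF ltrz0 intr_eq0.
by case: (cmpzP n) => h; [rewrite h|rewrite h|rewrite lt_gtF // gt_eqF].
Qed.

Section Coefs.
Variables a b c d : int.
Hypotheses (D : 0 < a * d - b * c) (nA : normal4 a c).
Let N := pm (mx2 a b c d).

Lemma fHE : fH N = (coefH (signs_of a b c d))%:~R / 12 :> R.
Proof.
rewrite /fH bracketE // /coefH /= isgt_cmpz iseq_cmpz nestedE.
by case: ifP => _; rewrite ?mul0r // -cmpzN; congr ((wt _ (cmpz _) (cmpz _))%:~R / _); lia.
Qed.

Lemma fXE : fX N = (coefX (signs_of a b c d))%:~R / 12 :> R.
Proof.
rewrite /fX bracketE // /coefX /= isgt_cmpz islt_cmpz independentE.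
by case: ifP => _; rewrite ?mul0r //; congr ((wt _ (cmpz _) (cmpz _))%:~R / _); lia.
Qed.

Lemma fYE : fY N = (coefY (signs_of a b c d))%:~R / 12 :> R.
Proof.
rewrite /fY bracketE // /coefY /= !isgt_cmpz nestedE subr_gt0.
by case: ifP => _; rewrite ?mul0r // -cmpzN; congr ((wt _ (cmpz _) (cmpz _))%:~R / _); lia.
Qed.

Lemma fZE : fZ N = (coefZ (signs_of a b c d))%:~R / 12 :> R.
Proof.
rewrite /fZ bracketE // /coefZ /= !isgt_cmpz nestedE.
by case: ifP => _; rewrite ?mul0r // -!cmpzN; congr ((wt _ (cmpz _) (cmpz _))%:~R / _); lia.
Qed.

Lemma wtl0 w k k' : k = Lt -> wt w k k' = 0.
Proof. by move->. Qed.
Lemma wtr0 w k k' : k' = Lt -> wt w k k' = 0.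
Proof. by move->; case: k. Qed.
Lemma cmpz_lt x : x < 0 -> cmpz x = Lt.
Proof. by case: (cmpzP x) => //; lia. Qed.

Lemma SNS_E : Mmul Smat (Mmul N Smat) = pm (mx2 (- d) c b (- a)).
Proof.
rewrite !Mmul_pm2; [|by []|lia|by []|lia].
by apply: pm2_eq; lia.
Qed.

(** If [[-d, c], [b, -a]] is itself normal, both sides vanish: X would need c < 0, while b >= 0 and
    c > 0 contradict the inequality b + c <= 0 of [coefSXS]. Otherwise its negative is the
    representative. *)
Lemma fSXSE : fX (Mmul Smat (Mmul N Smat)) = (coefSXS (signs_of a b c d))%:~R / 12 :> R.
Proof.
rewrite SNS_E /coefSXS /= !isgt_cmpz /fX; have nA' := nA; rewrite /normal4 in nA'.
case nA2: (normal4 (- d) b).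
  rewrite bracketE //; last lia.
  rewrite /normal4 in nA2; rewrite ifF; last lia.
  case: ifP => h; rewrite ?mul0r // -!cmpzN.
  have [b0|b0] := ltP 0 b.
    by rewrite wtr0 ?mul0r // cmpz_lt //; lia.
  by rewrite wtl0 ?mul0r // cmpz_lt; nia.
have d0 : b = 0 -> d <> 0 by move=> b0 d0; move: D; rewrite b0 d0; lia.
rewrite -pmN ?det_mx2; last lia.
rewrite opp_mx2 bracketE; [|lia|by rewrite /normal4 in nA2 *; lia].
rewrite opprK independentE (_ : (- c < 0) && _ = (0 < c) && (0 < a)); last lia.
by case: ifP => _; rewrite ?mul0r // -!cmpzN; congr ((wt _ (cmpz _) (cmpz _))%:~R / _); lia.
Qed.

Lemma UNU_E : Mmul Umat (Mmul N (Mmul Umat Umat)) =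
  pm (mx2 (d - b) (a + b - c - d) (- b) (a + b)).
Proof.
rewrite UUE !Mmul_pm2; [|by []|lia|by []|lia].
rewrite -pmN ?det_mx2; last lia.
by rewrite opp_mx2; apply: pm2_eq; lia.
Qed.

(** The representative of U N U^-1 in [UNU_E] is normal if b < 0, or if b = 0 and d > 0. For the
    opposite sign, Y would need both b > 0 and b + c <= 0. *)
Lemma fUYUE : fY (Mmul Umat (Mmul N (Mmul Umat Umat))) =
  (coefUYU (signs_of a b c d))%:~R / 12 :> R.
Proof.
rewrite UNU_E /coefUYU /= isgt_cmpz islt_cmpz /fY; have nA' := nA; rewrite /normal4 in nA'.
case nA2: (normal4 (d - b) (- b)).
  rewrite bracketE //; last lia.
  rewrite nestedE (_ : (0 < - b) && _ = (b < 0) && (0 < d)); last lia.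
  by case: ifP => _; rewrite ?mul0r //; congr ((wt _ (cmpz _) (cmpz _))%:~R / _); lia.
rewrite /normal4 in nA2; rewrite [(b < 0) && _](_ : _ = false) /= ?mul0r; last lia.
rewrite -pmN ?det_mx2; last lia.
have d0 : b = 0 -> d <> 0 by move=> b0 d0; move: D; rewrite b0 d0; lia.
rewrite opp_mx2 bracketE; [|lia|by rewrite /normal4; lia].
case: ifP => h; rewrite ?mul0r // nestedE wtl0 ?mul0r // cmpz_lt //; lia.
Qed.

Lemma fUZUE : fZ (Mmul Umat (Mmul N (Mmul Umat Umat))) =
  (coefUZU (signs_of a b c d))%:~R / 12 :> R.
Proof.
rewrite UNU_E /coefUZU /= !islt_cmpz /fZ; have nA' := nA; rewrite /normal4 in nA'.
case nA2: (normal4 (d - b) (- b)).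
  rewrite bracketE //; last lia.
  rewrite nestedE (_ : (0 < d - b) && _ = (b < 0) && (b - d < 0)); last lia.
  by case: ifP => _; rewrite ?mul0r // -cmpzN; congr ((wt _ (cmpz _) (cmpz _))%:~R / _); lia.
rewrite /normal4 in nA2; rewrite [(b < 0) && _](_ : _ = false) /= ?mul0r; last lia.
rewrite -pmN ?det_mx2; last lia.
have d0 : b = 0 -> d <> 0 by move=> b0 d0; move: D; rewrite b0 d0; lia.
rewrite opp_mx2 bracketE; [|lia|by rewrite /normal4; lia].
case: ifP => h; rewrite ?mul0r // nestedE.
have [?|?] := ltP 0 (a + b - d).
  by rewrite wtl0 ?mul0r // cmpz_lt //; lia.
by rewrite wtr0 ?mul0r // cmpz_lt //; lia.
Qed.

Lemma ellipticE : elliptic N = ((a - d) ^+ 2 < - (4 * b * c)).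
Proof.
have trE : \tr (mx2 a b c d) = a + d.
  rewrite /mxtrace !big_ord_recl big_ord0 addr0 (_ : lift 0 0 = 1) ?mx2E //.
  exact/val_inj.
rewrite /elliptic det_rep_pm ?det_mx2 // rep_pm ?det_mx2 // pos_rep_mx2 nA trE.
by apply/idP/idP; lia.
Qed.

(** Fixed points solve c z^2 + (d - a) z - b = 0. Its discriminant is negative, so the roots have
    real part (a - d) / (2 c) and squared modulus -b / c; ellipticity also forces c > 0. *)
Lemma fixed_pointE : elliptic N -> exists2 y : R, 0 < y /\
    ((a - d)%:~R / (2 * c%:~R)) ^+ 2 + y ^+ 2 = - b%:~R / c%:~R &
    fixed_point N = ((a - d)%:~R / (2 * c%:~R) +i* y)%C.
Proof.
rewrite ellipticE => ell; have c0 : 0 < c by move: nA; rewrite /normal4; nia.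
have cR : 0 < c%:~R :> R by rewrite ltr0z.
set x : R := _ / _.
have xE : x * (2 * c%:~R) = a%:~R - d%:~R.
  by rewrite /x divfK ?rmorphB // mulf_neq0 // gt_eqF.
have y2 : 0 < - b%:~R / c%:~R - x ^+ 2.
  have : 0 < - (4 * b * c)%:~R - ((a - d) ^+ 2)%:~R :> R.
    by rewrite -rmorphN -rmorphB ltr0z subr_gt0.
  rewrite rmorphXn rmorphB -xE !rmorphM /= => h.
  have : 0 < (4 * c%:~R ^+ 2) * (- b%:~R / c%:~R - x ^+ 2).
    rewrite mulrBr (_ : 4 * c%:~R ^+ 2 * (- b%:~R / c%:~R) = - (4 * b%:~R * c%:~R)).
      by move: h; nra.
    by field; rewrite gt_eqF.
  by rewrite pmulr_rgt0 // mulr_gt0 // exprn_gt0.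
exists (Num.sqrt (- b%:~R / c%:~R - x ^+ 2)).
  by rewrite sqrtr_gt0 y2; split=> //; rewrite sqr_sqrtr ?ltW //; lra.
set y := Num.sqrt _; have y0 : 0 < y by rewrite sqrtr_gt0.
have yE : c%:~R * (x ^+ 2 + y ^+ 2) = - b%:~R.
  by rewrite sqr_sqrtr ?ltW // addrC subrK mulrC divfK ?gt_eqF.
have fixE (w : R[i]) : is_fixed_point N w <-> [/\ 0 < complex.Im w,
    complex.Re w * (2 * c%:~R) = a%:~R - d%:~R &
    c%:~R * ((complex.Re w) ^+ 2 + (complex.Im w) ^+ 2) = - b%:~R].
  rewrite /is_fixed_point rep_pm ?det_mx2 // pos_rep_mx2 nA !mx2E.
  have toC (n : int) : n%:~R = (n%:~R : R)%:C%C by rewrite rmorph_int.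
  case: w => u v; rewrite !toC.
  rewrite /=; split=> [[v0]|[v0 uE vE]].
    move=> /(iffLR (divr_eq_mulr _ _ (mobius_den_neq0 u d%:~R (lt0r_neq0 cR) v0))).
    case=> h1 h2; split=> //.
      by apply: (mulIf (lt0r_neq0 v0)); nra.
    have uE : u * (2 * c%:~R) = a%:~R - d%:~R by apply: (mulIf (lt0r_neq0 v0)); nra.
    nra.
  split=> //; apply: (iffRL (divr_eq_mulr _ _ (mobius_den_neq0 u d%:~R (lt0r_neq0 cR) v0))).
  by congr Complex; nra.
apply: xget_unique; first by apply/fixE.
move=> [u v] /fixE[/= v0 uE vE].
have uxE : u = x by apply: (mulIf (x := 2 * c%:~R)); rewrite ?uE ?xE // mulf_neq0 // gt_eqF.
rewrite uxE; congr Complex; apply/eqP; rewrite -(eqrXn2 (n := 2)) ?ltW //; apply/eqP.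
by apply: (mulfI (lt0r_neq0 cR)); move: yE vE; rewrite uxE; lra.
Qed.

(** At the fixed point z = x + i y, the numbers x, 1/2 - x and |z - 1|^2 - 1 are positive multiples
    of a - d, c + d - a and d - a - b. *)
Lemma fEE : fE N = (coefE (signs_of a b c d))%:~R / 12 :> R.
Proof.
rewrite /fE /coefE /= isgt_cmpz islt_cmpz.
have [ell|nell] := boolP (elliptic N); last first.
  case: ifP => [/andP[c0 b0]|_]; last by rewrite mul0r.
  rewrite ellipticE in nell.
  (* A nonzero weight means 0 <= a - d, a - d <= c and a - d <= -b, so (a - d)^2 <= -b c < -4 b c
     and the matrix would be elliptic. *)
  case: (cmpzP (a - d)) => h1; case: (cmpzP (a - c - d)) => h2; case: (cmpzP (a + b - d)) => h3;
    rewrite /= ?mul0r //; exfalso; nia.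
have [y [y0 xy] ->] := fixed_pointE ell; rewrite ellipticE in ell.
have c0 : 0 < c by move: nA; rewrite /normal4; nia.
have b0 : b < 0 by nia.
rewrite c0 b0 chiE //= -!cmpzN.
have cR : 0 < c%:~R :> R by rewrite ltr0z.
have k2 : 0 < (2 * c%:~R)^-1 :> R by rewrite invr_gt0 mulr_gt0.
congr ((wt3 _ _ _)%:~R / _).
- exact: cmpR_scale.
- rewrite -(cmpR_scale _ k2); congr cmpR.
  by rewrite !rmorphN !rmorphB /=; field; rewrite gt_eqF.
- rewrite -[RHS](@cmpR_scale (c%:~R)^-1) ?invr_gt0 //; congr cmpR.
  set x := _ / _ in xy *.
  have -> : (x - 1) ^+ 2 + y ^+ 2 - 1 = (x ^+ 2 + y ^+ 2) - 2 * x by ring.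
  rewrite xy /x !rmorphN !rmorphB !rmorphD /=; field; rewrite gt_eqF //.
Qed.

Lemma Ttilde_normal : Ttilde R N = (coef (signs_of a b c d))%:~R / 12.
Proof.
rewrite TtildeE fEE fHE fXE fSXSE fYE fUYUE fZE fUZUE /coef normal_signs_of nA /coef_normal.
rewrite !(intrD, mulrNz); ring.
Qed.
End Coefs.

Lemma signs_ofN a b c d : signs_of (- a) (- b) (- c) (- d) = opps (signs_of a b c d).
Proof. by rewrite /signs_of /= -!cmpzN; congr Signs; congr cmpz; lia. Qed.

Lemma coef_opps a b c d : 0 < a * d - b * c ->
  coef (opps (signs_of a b c d)) = coef (signs_of a b c d).
Proof.
move=> D; have E : opps (opps (signs_of a b c d)) = signs_of a b c d.
  by rewrite /= !CompOpp_involutive.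
rewrite /coef E -signs_ofN !normal_signs_of /normal4.
have ac : (a != 0) || (c != 0) by move: D; case: eqP => // ->; case: eqP => // ->; lia.
case: ifP; case: ifP => //; lia.
Qed.

(** Holds for either representative modulo sign, so the sign identities apply to M S, U M and other
    products without normalising them. *)
Lemma Ttilde_pm a b c d : 0 < a * d - b * c ->
  Ttilde R (pm (mx2 a b c d)) = (coef (signs_of a b c d))%:~R / 12.
Proof.
move=> D; have [nA|nA] := boolP (normal4 a c); first exact: Ttilde_normal.
rewrite -pmN ?det_mx2 // opp_mx2 Ttilde_normal.
- by rewrite signs_ofN coef_opps.
- lia.
- move: nA; rewrite /normal4.
  have ac : (a != 0) || (c != 0) by move: D; case: eqP => // ->; case: eqP => // ->; lia.
  lia.
Qed.
End Coefficients.

(* Otherwise unification may try to compute with the closed matrices S and U. *)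
Opaque Mmul pm Ttilde Umat Smat.

(** * Invariance and finiteness *)

Lemma matpm_pm2 (M : matpm) : exists a b c d : int,
  0 < a * d - b * c /\ M = pm (mx2 a b c d).
Proof.
exists (rep M 0 0), (rep M 0 1), (rep M 1 0), (rep M 1 1).
by rewrite -det_mx2 -mx2_eta repK det_rep_gt0.
Qed.

Section Mul.
Variables a b c d : int.
Hypothesis D : 0 < a * d - b * c.
Let M := pm (mx2 a b c d).

Lemma mulS_l : Mmul Smat M = pm (mx2 (- c) (- d) a b).
Proof. by rewrite Mmul_pm2 //; apply: pm2_eq; lia. Qed.
Lemma mulS_r : Mmul M Smat = pm (mx2 b (- a) d (- c)).
Proof. by rewrite Mmul_pm2 //; apply: pm2_eq; lia. Qed.
Lemma mulU_l : Mmul Umat M = pm (mx2 (a - c) (b - d) a b).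
Proof. by rewrite Mmul_pm2 //; apply: pm2_eq; lia. Qed.
Lemma mulU_r : Mmul M Umat = pm (mx2 (a + b) (- a) (c + d) (- c)).
Proof. by rewrite Mmul_pm2 //; apply: pm2_eq; lia. Qed.
Lemma mulU2_r : Mmul M (Mmul Umat Umat) = pm (mx2 b (- (a + b)) d (- (c + d))).
Proof. by rewrite UUE Mmul_pm2 //; apply: pm2_eq; lia. Qed.
End Mul.

Section Invariance.
Context {R : realType}.
Notation T := (Ttilde R).

(** [symS] and [symU] are the coefficient functions of T (1 + S) and T (1 + U + U^2): inversion
    fixes S and exchanges U and U^2. *)
Definition symS (M : matpm) := T M + T (Mmul M Smat).
Definition symU (M : matpm) := T M + T (Mmul M Umat) + T (Mmul M (Mmul Umat Umat)).

Lemma symS_U M : symS (Mmul Umat M) = symS M.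
Proof.
have [a [b [c [d [D ->]]]]] := matpm_pm2 M.
have DU : 0 < (a - c) * b - (b - d) * a by lia.
rewrite /symS (mulU_l D) (mulS_r D) (mulS_r DU) !Ttilde_pm; [|lia..].
by rewrite -!mulrDl -!intrD (coef_symS D) opprB.
Qed.

Lemma symU_S M : symU (Mmul Smat M) = symU M.
Proof.
have [a [b [c [d [D ->]]]]] := matpm_pm2 M.
have DS : 0 < - c * b - - d * a by lia.
rewrite /symU (mulS_l D) (mulU_r D) (mulU2_r D) (mulU_r DS) (mulU2_r DS).
rewrite !Ttilde_pm; [|lia..].
by rewrite -!mulrDl -!intrD (coef_symU D) !opprD !opprK.
Qed.
End Invariance.

(** * Bounds on the entries of the matrices in the support *)

Section Bounds.
Variables (a b c d n : int).
Hypothesis D : a * d - b * c = n.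

(** As 4 a d = (a + d)^2 - (a - d)^2 and (a - d)^2 <= -b c, four times the determinant is at least
    (a + d)^2 - 3 b c, a sum of nonnegative terms. *)
Lemma boundE : 0 < c -> b < 0 -> 0 <= a - d -> a - d <= c -> a + b <= d ->
  [/\ `|a| <= 4 * n, `|b| <= 4 * n, `|c| <= 4 * n & `|d| <= 4 * n].
Proof.
move=> c0 b0 h1 h2 h3.
have p2 : (a - d) ^+ 2 <= - b * c by nia.
have n4 : (a + d) ^+ 2 + 3 * (- b * c) <= 4 * n by nia.
have cb : c <= - b * c by nia.
have bb : - b <= - b * c by nia.
have s0 := sqr_ge0 (a + d).
have s1 : `|a + d| <= 4 * n.
  have [h|h] := leP 0 (a + d).
    have : a + d <= (a + d) ^+ 2 by nia. lia.
  have : - (a + d) <= (a + d) ^+ 2 by nia. lia.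
split; lia.
Qed.

Lemma boundX : b < 0 -> 0 < d -> 0 <= a - d -> 0 <= b + c ->
  [/\ `|a| <= 4 * n, `|b| <= 4 * n, `|c| <= 4 * n & `|d| <= 4 * n].
Proof.
move=> h1 h2 h3 h4; have : a <= a * d by nia. have : d <= a * d by nia.
have : c <= - b * c by nia. have : - b <= - b * c by nia.
split; lia.
Qed.

(** If b < 0, then d >= a + b >= a - c > 0 and both a d and -b c are positive. If b >= 0, then n >=
    a^2 + b (a - c) and n >= a (d - b). *)
Lemma boundY : 0 < c -> c < a -> a + b - d <= 0 -> 0 <= b + c ->
  [/\ `|a| <= 4 * n, `|b| <= 4 * n, `|c| <= 4 * n & `|d| <= 4 * n].
Proof.
move=> h1 h2 h3 h4; have [b0|b0] := leP 0 b; last first.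
  have : a <= a * d by nia. have : d <= a * d by nia.
  have : c <= - b * c by nia. have : - b <= - b * c by nia.
  split; lia.
have : a ^+ 2 + b * (a - c) <= n by nia.
have : a <= a ^+ 2 by nia. have : b <= b * (a - c) by nia.
have : a * (d - b) <= n by nia. have : d - b <= a * (d - b) by nia.
split; lia.
Qed.

(** If d > 0, both a d and -b c are positive. Otherwise 0 < a - d <= c <= -b, so n >= a d + (a -
    d)^2 = a^2 - a d + d^2. *)
Lemma boundZ : 0 < a -> 0 < c -> a - d <= c -> b + c <= 0 ->
  [/\ `|a| <= 4 * n, `|b| <= 4 * n, `|c| <= 4 * n & `|d| <= 4 * n].
Proof.
move=> h1 h2 h3 h4.
have cb : c <= - b * c by nia. have bb : - b <= - b * c by nia.
have [d0|d0] := ltP 0 d.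
  have : a <= a * d by nia. have : d <= a * d by nia. split; lia.
have e : (a - d) ^+ 2 <= - b * c by nia.
have : a ^+ 2 + a * (- d) + d ^+ 2 <= n by nia.
have : a <= a ^+ 2 by nia. have : - d <= d ^+ 2 by nia.
have : 0 <= a * (- d) by nia.
split; lia.
Qed.

Lemma boundH : c = 0 -> 0 < a -> a + b - d <= 0 -> 0 <= b + c ->
  [/\ `|a| <= 4 * n, `|b| <= 4 * n, `|c| <= 4 * n & `|d| <= 4 * n].
Proof.
move=> c0 h1 h3 h4; have : a <= a * d by nia. have : d <= a * d by nia.
split; lia.
Qed.
End Bounds.

Lemma wt_neq0 w k1 k2 : wt w k1 k2 != 0 -> k1 <> Lt /\ k2 <> Lt.
Proof. by case: k1; case: k2. Qed.

Lemma wt3_neq0 k k1 k2 : wt3 k k1 k2 != 0 -> [/\ k <> Lt, k1 <> Lt & k2 <> Lt].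
Proof. by case: k; case: k1; case: k2. Qed.

Lemma cmpz_ge0 x : cmpz x <> Lt -> 0 <= x.
Proof. by case: (cmpzP x) => // h _; lia. Qed.

Lemma cmpz_le0 x : opp (cmpz x) <> Lt -> x <= 0.
Proof. by case: (cmpzP x) => // h _; lia. Qed.

Lemma coef_normal_neq0 s : coef_normal s != 0 ->
  [|| coefE s != 0, coefH s != 0, coefX s != 0, coefSXS s != 0, coefY s != 0,
      coefUYU s != 0, coefZ s != 0 | coefUZU s != 0].
Proof.
apply: contraNT; rewrite !negb_or !negbK.
case/and5P=> /eqP e1 /eqP e2 /eqP e3 /eqP e4 /and4P[/eqP e5 /eqP e6 /eqP e7 /eqP e8].
by rewrite /coef_normal e1 e2 e3 e4 e5 e6 e7 e8.
Qed.

(** A nonzero term puts the matrix, or its conjugate by S or U, under one of the bounds by 4 n.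
    Undoing a conjugation by U gives at most 16 n, so 40 leaves room. *)
Lemma coef_normal_bound a b c d : normal4 a c -> coef_normal (signs_of a b c d) != 0 ->
  let B := 40 * (a * d - b * c) in
  [/\ `|a| <= B, `|b| <= B, `|c| <= B & `|d| <= B].
Proof.
move=> nA; set n := a * d - b * c; cbv zeta => /coef_normal_neq0.
rewrite /coefE /coefH /coefX /coefSXS /coefY /coefUYU /coefZ /coefUZU /=.
rewrite !isgt_cmpz !islt_cmpz !iseq_cmpz.
case/orP; [|case/orP; [|case/orP; [|case/orP; [|case/orP; [|case/orP; [|case/orP]]]]]].
- case: ifP => // /andP[h1 h2] /wt3_neq0[/cmpz_ge0 h3 /cmpz_le0 h4 /cmpz_le0 h5].
  have [] : [/\ `|a| <= 4 * n, `|b| <= 4 * n, `|c| <= 4 * n & `|d| <= 4 * n].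
    by apply: boundE => //; lia.
  by split; lia.
- case: ifP => // /andP[/eqP h1 h2] /wt_neq0[/cmpz_le0 h4 /cmpz_ge0 h5].
  have [] : [/\ `|a| <= 4 * n, `|b| <= 4 * n, `|c| <= 4 * n & `|d| <= 4 * n].
    by apply: boundH => //; lia.
  by split; lia.
- case: ifP => // /andP[h1 h2] /wt_neq0[/cmpz_ge0 h4 /cmpz_ge0 h5].
  have [] : [/\ `|a| <= 4 * n, `|b| <= 4 * n, `|c| <= 4 * n & `|d| <= 4 * n].
    by apply: boundX => //; lia.
  by split; lia.
- case: ifP => // /andP[h1 h2] /wt_neq0[/cmpz_le0 h4 /cmpz_le0 h5].
  have [] : [/\ `|d| <= 4 * n, `|- c| <= 4 * n, `|- b| <= 4 * n & `|a| <= 4 * n].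
    by apply: boundX; rewrite /n; lia.
  by split; lia.
- case: ifP => // /andP[h1]; rewrite subr_gt0 => h2 /wt_neq0[/cmpz_le0 h4 /cmpz_ge0 h5].
  have [] : [/\ `|a| <= 4 * n, `|b| <= 4 * n, `|c| <= 4 * n & `|d| <= 4 * n].
    by apply: boundY => //; lia.
  by split; lia.
- case: ifP => // /andP[h1 h2] /wt_neq0[/cmpz_ge0 h4 /cmpz_ge0 h5].
  have [] : [/\ `|d - b| <= 4 * n, `|a + b - c - d| <= 4 * n, `|- b| <= 4 * n
      & `|a + b| <= 4 * n].
    by apply: boundY; rewrite /n; lia.
  by split; lia.
- case: ifP => // /andP[h1 h2] /wt_neq0[/cmpz_le0 h4 /cmpz_le0 h5].
  have [] : [/\ `|a| <= 4 * n, `|b| <= 4 * n, `|c| <= 4 * n & `|d| <= 4 * n].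
    by apply: boundZ => //; lia.
  by split; lia.
- case: ifP => // /andP[h1 h2] /wt_neq0[/cmpz_ge0 h4 /cmpz_le0 h5].
  have [] : [/\ `|d - b| <= 4 * n, `|a + b - c - d| <= 4 * n, `|- b| <= 4 * n
      & `|a + b| <= 4 * n].
    by apply: boundZ; rewrite /n; lia.
  by split; lia.
Qed.

(** * Rationality and finiteness of the support *)

Section Support.
Context {R : realType}.
Notation T := (Ttilde R).

Lemma Ttilde_rep M : T M =
  (coef_normal (signs_of (rep M 0 0) (rep M 0 1) (rep M 1 0) (rep M 1 1)))%:~R / 12.
Proof.
have nM : normal4 (rep M 0 0) (rep M 1 0) by case/andP: (matpmP M).
rewrite -{1}(repK M) {1}(mx2_eta (rep M)) Ttilde_pm -?det2 ?det_rep_gt0 //.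
by rewrite /coef normal_signs_of nM.
Qed.

Lemma rational_T : rational_coefs T.
Proof.
move=> M; rewrite Ttilde_rep; set k := coef_normal _.
by exists (k%:~R / 12); rewrite fmorph_div rmorph_int rmorph_nat.
Qed.

(** The box is covered by the image of a finite type: entries are shifted by B into 0, ..., 2 B. *)
Lemma finite_box (B : nat) : finite_set [set M : matpm | forall i j, `|rep M i j| <= B%:Z].
Proof.
pose f (p : 'M['I_(2 * B).+1]_2) : matpm := pm (\matrix_(i, j) ((p i j)%:Z - B%:Z)).
have fin : finite_set (range f) by apply: finite_image; exact: finite_finset.
apply: sub_finite_set fin.
move=> M MB; exists (\matrix_(i, j) inord (absz (rep M i j + B%:Z))) => //.
rewrite /f -[RHS]repK; congr pm; apply/matrixP=> i j; rewrite !mxE inordK.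
  by have := MB i j; lia.
by have := MB i j; lia.
Qed.

Lemma finite_T (n : nat) : finite_set [set M | detn n M /\ T M != 0].
Proof.
apply: sub_finite_set (finite_box (40 * n)) => M /= [dM TM].
have nM : normal4 (rep M 0 0) (rep M 1 0) by case/andP: (matpmP M).
move: TM; rewrite Ttilde_rep mulf_eq0 intr_eq0 negb_or => /andP[TM _].
have := coef_normal_bound nM TM; rewrite -det2 dM => -[h1 h2 h3 h4] i j.
by case: (ord2_cases i) => ->; case: (ord2_cases j) => ->; lia.
Qed.

Lemma Rhat_T : Rhat T.
Proof. by split; [exact: rational_T|move=> n; exact: finite_T]. Qed.
End Support.

(** * Membership in the images of the two projections *)

Section PartA.
Context {R : realType}.
Notation T := (Ttilde R).
Implicit Types (xi : formal R) (M N A B : matpm).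

Lemma det_S : \det (rep Smat) = 1.
Proof. by rewrite det_rep_pm ?det_mx2. Qed.
Lemma det_U : \det (rep Umat) = 1.
Proof. by rewrite det_rep_pm ?det_mx2. Qed.
Lemma det_UU : \det (rep (Mmul Umat Umat)) = 1.
Proof. by rewrite det_Mmul det_U. Qed.

(** Right multiplication by A is injective and preserves the determinant, so the preimage of the
    finite support of T is finite. *)
Lemma finite_shift n A B : \det (rep A) = 1 -> Mmul A B = Mone ->
  finite_set [set M | detn n M /\ T (Mmul M A) != 0].
Proof.
move=> dA AB.
have fin : finite_set ((fun M => Mmul M A) @^-1` [set M | detn n M /\ T M != 0]).
  apply: finite_preimage (finite_T n).
  move=> M N _ _ /(congr1 (fun P => Mmul P B)).
  by rewrite -!MmulA AB !MmulM1.
apply: sub_finite_set fin => M [dM TM]; split=> //.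
by rewrite /detn /= det_Mmul dA mulr1.
Qed.

Lemma finite_symS n : finite_set [set M | detn n M /\ symS (R := R) M != 0].
Proof.
have fin : finite_set ([set M | detn n M /\ T M != 0] `|`
    [set M | detn n M /\ T (Mmul M Smat) != 0]).
  by rewrite finite_setU; split; [exact: finite_T|exact: finite_shift det_S SS].
apply: sub_finite_set fin => M [dM]; rewrite /symS => h.
have [T0|T0] := eqVneq (T M) 0; last by left.
by right; split=> //; rewrite T0 add0r in h.
Qed.

Lemma add3r_neq0 (x y z : R) : x + y + z != 0 -> [|| x != 0, y != 0 | z != 0].
Proof.
by apply: contraNT; rewrite !negb_or !negbK => /and3P[/eqP-> /eqP-> /eqP->];
  rewrite !addr0.
Qed.

Lemma finite_symU n : finite_set [set M | detn n M /\ symU (R := R) M != 0].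
Proof.
have UU : Mmul (Mmul Umat Umat) Umat = Mone by rewrite -MmulA UUU.
have fin : finite_set ([set M | detn n M /\ T M != 0] `|`
    ([set M | detn n M /\ T (Mmul M Umat) != 0] `|`
     [set M | detn n M /\ T (Mmul M (Mmul Umat Umat)) != 0])).
  rewrite !finite_setU; split; [exact: finite_T|split].
    exact: finite_shift det_U UUU.
  exact: finite_shift det_UU UU.
apply: sub_finite_set fin => M [dM] /add3r_neq0 /or3P[h|h|h].
- by left.
- by right; left.
- by right; right.
Qed.

Lemma rational_div xi (k : nat) : rational_coefs xi -> rational_coefs (fun M => xi M / k%:R).
Proof.
by move=> q M; have [r ->] := q M; exists (r / k%:R); rewrite fmorph_div rmorph_nat.
Qed.

Lemma rational_symS : rational_coefs (symS (R := R)).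
Proof.
move=> M; have [q1 E1] := rational_T (R := R) M.
have [q2 E2] := rational_T (R := R) (Mmul M Smat).
by exists (q1 + q2); rewrite /symS E1 E2 rmorphD.
Qed.

Lemma rational_symU : rational_coefs (symU (R := R)).
Proof.
move=> M; have [q1 E1] := rational_T (R := R) M.
have [q2 E2] := rational_T (R := R) (Mmul M Umat).
have [q3 E3] := rational_T (R := R) (Mmul M (Mmul Umat Umat)).
by exists (q1 + q2 + q3); rewrite /symU E1 E2 E3 !rmorphD.
Qed.

Lemma finite_div xi n (k : nat) : finite_set [set M | detn n M /\ xi M != 0] ->
  finite_set [set M | detn n M /\ xi M / k%:R != 0].
Proof.
move=> fin; apply: sub_finite_set fin => M [dM h]; split=> //.
by apply: contraNN h => /eqP ->; rewrite mul0r.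
Qed.

Lemma Rhat_div xi k : rational_coefs xi ->
  (forall n, finite_set [set M | detn n M /\ xi M != 0]) ->
  Rhat (fun M => xi M / k%:R).
Proof. by move=> q fin; split=> [|n]; [exact: rational_div|exact: finite_div]. Qed.

Lemma QM_component xi n k : rational_coefs xi ->
  (forall n, finite_set [set M | detn n M /\ xi M != 0]) ->
  QM n (fun M => component n xi M / k%:R).
Proof.
move=> q fin; split.
- apply: rational_div => M; rewrite /component; case: ifP => _; first exact: q.
  by exists 0; rewrite rmorph0.
- apply: sub_finite_set (finite_div k (fin n)) => M; rewrite /= /component.
  by case: ifP => [/eqP|]; rewrite ?mul0r ?eqxx.
- by move=> M; rewrite /component; case: ifP => [/eqP|]; rewrite ?mul0r ?eqxx.
Qed.

(** [piU] averages over the powers of U. An invariant element is therefore its own witness for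
    membership in the image of [piU]. *)
Lemma fixed_by_piU xi : (forall M, xi (Mmul Umat M) = xi M) -> fmul piU xi = xi.
Proof.
move=> inv; apply/funext => M; rewrite /piU fmul_scalel fmul_oneU_l -MmulA !inv.
by move: (xi M) => x; lra.
Qed.

Lemma fixed_by_piS xi : (forall M, xi (Mmul Smat M) = xi M) -> fmul piS xi = xi.
Proof.
move=> inv; apply/funext => M; rewrite /piS fmul_scalel fmul_oneS_l !inv.
by move: (xi M) => x; lra.
Qed.

Lemma component_shift n xi M A : \det (rep A) = 1 ->
  component n xi (Mmul M A) = if \det (rep M) == n%:Z then xi (Mmul M A) else 0.
Proof. by move=> dA; rewrite /component det_Mmul dA mulr1. Qed.

Lemma component_inv n xi A : \det (rep A) = 1 -> (forall M, xi (Mmul A M) = xi M) ->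
  forall M, component n xi (Mmul A M) = component n xi M.
Proof. by move=> dA inv M; rewrite /component det_Mmul dA mul1r inv. Qed.

Lemma T_piS : (fmul piU @` Rhat) (fmul T piS).
Proof.
have E : fmul T piS = fun M => symS M / 2.
  by rewrite /piS fmul_scaler; apply/funext => M; rewrite fmul_oneS_r.
exists (fun M => symS M / 2); last by rewrite E fixed_by_piU // => M; rewrite symS_U.
exact: Rhat_div rational_symS finite_symS.
Qed.

Lemma T_piU : (fmul piS @` Rhat) (fmul T piU).
Proof.
have E : fmul T piU = fun M => symU M / 3.
  by rewrite /piU fmul_scaler; apply/funext => M; rewrite fmul_oneU_r.
exists (fun M => symU M / 3); last by rewrite E fixed_by_piS // => M; rewrite symU_S.
exact: Rhat_div rational_symU finite_symU.
Qed.

Lemma Tn_oneS n : (fmul (fone + fU + fU2) @` QM n) (fmul (component n T) (fone + fS)).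
Proof.
(* Dividing by 3 turns 1 + U + U^2 into [piU], which fixes the invariant component. *)
exists (fun M => component n (symS (R := R)) M / 3).
  exact: QM_component rational_symS finite_symS.
have E : fmul (component n T) (fone + fS) = component n (symS (R := R)).
  apply/funext => M; rewrite fmul_oneS_r component_shift ?det_S //.
  by rewrite /component; case: ifP => _; rewrite ?addr0.
rewrite E; rewrite -[RHS]fixed_by_piU.
  by rewrite /piU fmul_scalel; apply/funext => M; rewrite fmul_oneU_l fmul_oneU_l !mulrDl.
by apply: component_inv det_U _ => M; exact: symS_U.
Qed.

Lemma Tn_oneU n : (fmul (fone + fS) @` QM n) (fmul (component n T) (fone + fU + fU2)).
Proof.
exists (fun M => component n (symU (R := R)) M / 2).
  exact: QM_component rational_symU finite_symU.
have E : fmul (component n T) (fone + fU + fU2) = component n (symU (R := R)).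
  apply/funext => M; rewrite fmul_oneU_r !component_shift ?det_U ?det_UU //.
  by rewrite /component; case: ifP => _; rewrite ?addr0.
rewrite E; rewrite -[RHS]fixed_by_piS.
  by rewrite /piS fmul_scalel; apply/funext => M; rewrite fmul_oneS_l fmul_oneS_l !mulrDl.
by apply: component_inv det_S _ => M; exact: symU_S.
Qed.
End PartA.

(** * Sums over right cosets *)

(** M has no integral inverse in general; multiplying by its adjugate reduces to cancelling the
    determinant. Hence Gamma indexes M Gamma without repetition. *)
Lemma Mmul_inj (M : matpm) : injective (Mmul M).
Proof.
move=> A B /eq_pm; rewrite !det_mulmx !mulr_gt0 ?det_rep_gt0 // => /(_ isT isT) AB.
have cancel_det (X Y : 'M[int]_2) : rep M *m X = rep M *m Y -> X = Y.
  move=> /(congr1 (mulmx (\adj (rep M)))); rewrite !mulmxA mul_adj_mx !mul_scalar_mx.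
  move=> E; apply/matrixP => i j; have := congr1 (fun Z : 'M[int]_2 => Z i j) E.
  by rewrite !mxE; apply: mulfI; rewrite gt_eqF ?det_rep_gt0.
case: AB => [/cancel_det|]; first by move=> AB; apply: val_inj.
rewrite -mulmxN => /cancel_det AB.
by rewrite -(repK A) -(repK B) AB pmN // det_rep_gt0.
Qed.

Lemma pm2N (a b c d : int) : 0 < a * d - b * c ->
  pm (mx2 a b c d) = pm (mx2 (- a) (- b) (- c) (- d)).
Proof. by move=> D; rewrite -opp_mx2 pmN ?det_mx2. Qed.

Section CosetSum.
Context {R : realType}.
Notation T := (Ttilde R).

Definition coset_sum (M : matpm) : R := \sum_(g \in Gamma) T (Mmul M g).

Lemma pairing_coset_sum M : pairing T (Mmul M @` Gamma) = coset_sum M.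
Proof.
rewrite /pairing (fsbig_image Gamma (Mmul M)) //.
by move=> A B _ _; apply: Mmul_inj.
Qed.

(** Left multiplication by M embeds this set in the finite support at one determinant. Finiteness is
    what allows sums over Gamma to be split. *)
Lemma finite_coset_sum M A B : \det (rep A) = 1 -> Mmul A B = Mone ->
  finite_set [set g | Gamma g /\ T (Mmul (Mmul M g) A) != 0].
Proof.
move=> dA AB; pose n := `|\det (rep M)|%N.
have fin : finite_set (Mmul M @^-1` [set N | detn n N /\ T (Mmul N A) != 0]).
  by apply: finite_preimage (finite_shift n dA AB) => g h _ _; apply: Mmul_inj.
apply: sub_finite_set fin => g [dg h]; split=> //.
rewrite /detn /= det_Mmul (_ : \det (rep g) = 1) // mulr1.
by rewrite /n gtz0_abs ?det_rep_gt0.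
Qed.

Lemma finite_coset_sum1 M : finite_set [set g | Gamma g /\ T (Mmul M g) != 0].
Proof.
have d1 : \det (rep Mone) = 1 by rewrite det1.
apply: sub_finite_set (finite_coset_sum M d1 (MmulM1 _)) => g [dg h].
by split=> //; rewrite MmulM1.
Qed.

Lemma fsum_add (f h : matpm -> R) :
  finite_set [set g | Gamma g /\ f g != 0] ->
  finite_set [set g | Gamma g /\ h g != 0] ->
  \sum_(g \in Gamma) (f g + h g) = \sum_(g \in Gamma) f g + \sum_(g \in Gamma) h g.
Proof.
move=> ff fh; pose A := [set g | Gamma g /\ f g != 0] `|` [set g | Gamma g /\ h g != 0].
have fA : finite_set A by rewrite finite_setU.
have AG : A `<=` Gamma by move=> g [[]|[]].
rewrite -(fsbig_widen A Gamma) //; last first.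
  move=> g [Gg nA] /=; apply/eqP; apply: contra_notT nA => fh0.
  have [f0|f0] := eqVneq (f g) 0; last by left.
  by right; split=> //; rewrite f0 add0r in fh0.
rewrite fsbig_split //; congr (_ + _); apply: fsbig_widen => //.
  move=> g [Gg nA] /=; apply/eqP; apply: contra_notT nA => f0.
  by left.
move=> g [Gg nA] /=; apply/eqP; apply: contra_notT nA => f0.
by right.
Qed.

Lemma fsum_shift (f : matpm -> R) A B : Mmul A B = Mone -> Mmul B A = Mone ->
  \det (rep A) = 1 -> \det (rep B) = 1 ->
  \sum_(g \in Gamma) f (Mmul g A) = \sum_(g \in Gamma) f g.
Proof.
move=> AB BA dA dB; rewrite [RHS](reindex_fsbig (fun g => Mmul g A) Gamma) //; split.
- by move=> g Gg; rewrite /Gamma /detn /= det_Mmul Gg dA.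
- move=> g h _ _ /(congr1 (fun P => Mmul P B)).
  by rewrite -!MmulA AB !MmulM1.
- move=> g Gg; exists (Mmul g B); first by rewrite /Gamma /detn /= det_Mmul Gg dB.
  by rewrite -MmulA BA MmulM1.
Qed.

Lemma coset_sum_r M A B : Mmul A B = Mone -> Mmul B A = Mone ->
  \det (rep A) = 1 -> \det (rep B) = 1 -> coset_sum (Mmul M A) = coset_sum M.
Proof.
move=> AB BA dA dB; rewrite /coset_sum [RHS](reindex_fsbig (Mmul A) Gamma).
  by apply: eq_fsbigr => g _; rewrite (MmulA M).
split.
- by move=> g Gg; rewrite /Gamma /detn /= det_Mmul Gg dA.
- by move=> g h _ _; apply: Mmul_inj.
- move=> g Gg; exists (Mmul B g); first by rewrite /Gamma /detn /= det_Mmul Gg dB.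
  by rewrite MmulA AB Mmul1M.
Qed.

(** Right translation by S permutes Gamma, so both terms of [symS] have the same sum. *)
Lemma sum_symS M : \sum_(g \in Gamma) symS (R := R) (Mmul M g) = coset_sum M + coset_sum M.
Proof.
rewrite /symS fsum_add; [|exact: finite_coset_sum1|exact: finite_coset_sum det_S SS].
congr (_ + _); rewrite /coset_sum -[RHS](fsum_shift _ SS SS det_S det_S).
by apply: eq_fsbigr => g _; rewrite (MmulA M).
Qed.

Lemma sum_symU M :
  \sum_(g \in Gamma) symU (R := R) (Mmul M g) = coset_sum M + coset_sum M + coset_sum M.
Proof.
have UU : Mmul (Mmul Umat Umat) Umat = Mone by rewrite -MmulA UUU.
have f1 := finite_coset_sum1 M; have f2 := finite_coset_sum M det_U UUU.
have f3 := finite_coset_sum M det_UU UU.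
rewrite /symU fsum_add //; last first.
  apply: sub_finite_set (_ : finite_set ([set g | Gamma g /\ T (Mmul M g) != 0] `|`
    [set g | Gamma g /\ T (Mmul (Mmul M g) Umat) != 0])) => [g [Gg h]|].
    have [T0|T0] := eqVneq (T (Mmul M g)) 0; last by left.
    by right; split=> //; rewrite T0 add0r in h.
  by rewrite finite_setU.
rewrite fsum_add //; congr (_ + _ + _); rewrite /coset_sum.
  rewrite -[RHS](fsum_shift _ UUU UU det_U det_UU).
  by apply: eq_fsbigr => g _; rewrite (MmulA M).
rewrite -[RHS](fsum_shift _ UU UUU det_UU det_U).
by apply: eq_fsbigr => g _; rewrite (MmulA M).
Qed.

Lemma coset_sum_U M : coset_sum (Mmul Umat M) = coset_sum M.
Proof.
have : coset_sum (Mmul Umat M) + coset_sum (Mmul Umat M) = coset_sum M + coset_sum M.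
  rewrite -!sum_symS; apply: eq_fsbigr => g _.
  by rewrite -MmulA symS_U.
by move: (coset_sum _) (coset_sum _) => x y; lra.
Qed.

Lemma coset_sum_S M : coset_sum (Mmul Smat M) = coset_sum M.
Proof.
have : coset_sum (Mmul Smat M) + coset_sum (Mmul Smat M) + coset_sum (Mmul Smat M) =
    coset_sum M + coset_sum M + coset_sum M.
  rewrite -!sum_symU; apply: eq_fsbigr => g _.
  by rewrite -MmulA symU_S.
by move: (coset_sum _) (coset_sum _) => x y; lra.
Qed.

(** * Elementary operations and reduction to diagonal matrices *)

Definition coset_sum4 (a b c d : int) : R := coset_sum (pm (mx2 a b c d)).

Section Moves.
Variables a b c d : int.
Hypothesis D : 0 < a * d - b * c.

Lemma coset_sum4_Sl : coset_sum4 (- c) (- d) a b = coset_sum4 a b c d.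
Proof. by rewrite /coset_sum4 -(mulS_l D) coset_sum_S. Qed.

Lemma coset_sum4_Sr : coset_sum4 b (- a) d (- c) = coset_sum4 a b c d.
Proof. by rewrite /coset_sum4 -(mulS_r D) (coset_sum_r _ SS SS det_S det_S). Qed.

(** This column operation is right multiplication by [[1, k], [0, 1]], which preserves the coset. *)
Lemma coset_sum4_col (k : int) : coset_sum4 a (b + k * a) c (d + k * c) = coset_sum4 a b c d.
Proof.
have d1 (l : int) : 0 < 1 * 1 - l * 0 :> int by lia.
have inv (l : int) : Mmul (pm (mx2 1 l 0 1)) (pm (mx2 1 (- l) 0 1)) = Mone.
  rewrite (Mmul_pm2 (d1 l) (d1 (- l))) Mone_pm mx2_1.
  by apply: pm2_eq; lia.
have det (l : int) : \det (rep (pm (mx2 1 l 0 1))) = 1.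
  by rewrite det_rep_pm det_mx2; lia.
have inv' := inv (- k); rewrite opprK in inv'.
rewrite /coset_sum4 -[RHS](coset_sum_r _ (inv k) inv' (det _) (det _)).
by rewrite (Mmul_pm2 D (d1 k)); apply: (congr1 coset_sum); apply: pm2_eq; lia.
Qed.

(** Modulo sign, S U is [[1, 0], [-1, 1]], so the two invariances on the left give this row
    operation. *)
Lemma coset_sum4_rowsub : coset_sum4 a b (c - a) (d - b) = coset_sum4 a b c d.
Proof.
have DU : 0 < (a - c) * b - (b - d) * a by lia.
have DR : 0 < a * (d - b) - b * (c - a) by lia.
rewrite /coset_sum4 -[RHS]coset_sum_U -[RHS]coset_sum_S (mulU_l D) (mulS_l DU) (pm2N DR).
by apply: (congr1 coset_sum); apply: pm2_eq; lia.
Qed.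

(** Modulo sign, U S is [[1, 1], [0, 1]]. *)
Lemma coset_sum4_rowadd : coset_sum4 (a + c) (b + d) c d = coset_sum4 a b c d.
Proof.
have DS : 0 < - c * b - - d * a by lia.
have DR : 0 < (a + c) * d - (b + d) * c by lia.
rewrite /coset_sum4 -[RHS]coset_sum_S -[RHS]coset_sum_U (mulS_l D) (mulU_l DS) (pm2N DR).
by apply: (congr1 coset_sum); apply: pm2_eq; lia.
Qed.
End Moves.

Lemma coset_sum4_row (a b c d k : int) : 0 < a * d - b * c ->
  coset_sum4 a b (c + k * a) (d + k * b) = coset_sum4 a b c d.
Proof.
have pos (n : nat) c' d' : 0 < a * d' - b * c' ->
    coset_sum4 a b (c' - n%:Z * a) (d' - n%:Z * b) = coset_sum4 a b c' d'.
  elim: n => [|n IH] D; first by rewrite !mul0r !subr0.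
  have D2 : 0 < a * (d' - n%:Z * b) - b * (c' - n%:Z * a) by lia.
  rewrite -[RHS](IH D) -[RHS](coset_sum4_rowsub D2).
  by apply: (congr1 coset_sum); apply: pm2_eq; lia.
move=> D; case: k => n.
  have D2 : 0 < a * (d + n%:Z * b) - b * (c + n%:Z * a) by lia.
  (* For k >= 0 the subtraction is applied to the modified row and leads back to the original
     one. *)
  rewrite -[LHS](pos n _ _ D2).
  by apply: (congr1 coset_sum); apply: pm2_eq; lia.
rewrite -[RHS](pos n.+1 _ _ D) NegzE; by apply: (congr1 coset_sum); apply: pm2_eq; lia.
Qed.

Lemma coset_sum4N (a b c d : int) : 0 < a * d - b * c ->
  coset_sum4 (- a) (- b) (- c) (- d) = coset_sum4 a b c d.
Proof. by move=> D; rewrite /coset_sum4 -(pm2N D). Qed.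

(* Euclid's algorithm on the first row and column, keeping track of |a|. *)
Lemma coset_sum4_Smith (P : R -> Prop) :
  (forall m e : int, 0 < m -> 0 < e -> P (coset_sum4 (m * e) 0 0 e)) ->
  forall a b c d : int, 0 < a * d - b * c -> P (coset_sum4 a b c d).
Proof.
move=> Pdiag.
suff main (n : nat) (a b c d : int) : `|a| <= n%:Z -> a != 0 -> 0 < a * d - b * c ->
    P (coset_sum4 a b c d).
  move=> a b c d D; have [a0|a0] := eqVneq a 0; last exact: (main `|a|%N).
  (* If the corner is 0, then b is nonzero by the determinant, and S on the right brings it to the
     corner. *)
  rewrite -(coset_sum4_Sr D); apply: (main `|b|%N); [lia| |lia].
  by apply: contraTneq D => b0; rewrite a0 b0; lia.
elim: n a b c d => [|n IH] a b c d an a0 D; first by lia.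
have reduce_col b' c' d' : 0 < a * d' - b' * c' -> (b' %% a)%Z != 0 -> P (coset_sum4 a b' c' d').
  move=> D' r0; rewrite -(coset_sum4_col D' (- (b' %/ a)%Z)).
  have Er : b' + - (b' %/ a)%Z * a = (b' %% a)%Z by have := divz_eq b' a; lia.
  have D2 : 0 < a * (d' + - (b' %/ a)%Z * c') - (b' %% a)%Z * c' by rewrite -Er; lia.
  (* S on the right moves the nonzero remainder, smaller than |a|, into the corner. *)
  rewrite Er -(coset_sum4_Sr D2); apply: IH; [|exact: r0|lia].
  by have := ltz_mod b' a0; have := modz_ge0 b' a0; lia.
have reduce_row c' d' : 0 < a * d' - b * c' -> (c' %% a)%Z != 0 -> P (coset_sum4 a b c' d').
  move=> D' r0; rewrite -(coset_sum4_row (- (c' %/ a)%Z) D').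
  have Er : c' + - (c' %/ a)%Z * a = (c' %% a)%Z by have := divz_eq c' a; lia.
  have D2 : 0 < a * (d' + - (c' %/ a)%Z * b) - b * (c' %% a)%Z by rewrite -Er; lia.
  rewrite Er -(coset_sum4_Sl D2) -coset_sum4N; last lia.
  rewrite !opprK; apply: IH; [|exact: r0|lia].
  by have := ltz_mod c' a0; have := modz_ge0 c' a0; lia.
have [c0|] := eqVneq (c %% a)%Z 0; last exact: reduce_row.
rewrite -(coset_sum4_row (- (c %/ a)%Z) D).
have Ec : c + - (c %/ a)%Z * a = 0 by have := divz_eq c a; lia.
set d1 := d + _; have D1 : 0 < a * d1 - b * 0 by rewrite -Ec /d1; lia.
rewrite Ec; have [b0|] := eqVneq (b %% a)%Z 0; last exact: reduce_col.
rewrite -(coset_sum4_col D1 (- (b %/ a)%Z)) mulr0 addr0.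
have Eb : b + - (b %/ a)%Z * a = 0 by have := divz_eq b a; lia.
have D0 : 0 < a * d1 - 0 * 0 by lia.
rewrite Eb; have [d0|r0] := eqVneq (d1 %% a)%Z 0; last first.
  (* The matrix is diagonal but a does not divide d1: adding the second row to the first puts d1
     beside a, and the algorithm goes on. *)
  rewrite -(coset_sum4_rowadd D0) addr0 add0r; apply: reduce_col; [lia|exact: r0].
have Ed : d1 = (d1 %/ a)%Z * a by have := divz_eq d1 a; lia.
set q := (d1 %/ a)%Z in Ed; have q0 : 0 < q by rewrite Ed in D0; nia.
have DS : 0 < 0 * 0 - - d1 * a by lia.
(* S on both sides exchanges the diagonal entries up to sign, so that the multiple q a comes
   first. *)
rewrite -(coset_sum4_Sl D0) -(coset_sum4_Sr DS) !oppr0 Ed.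
have [a1|a1] := ltP 0 a.
  rewrite -coset_sum4N; last by nia.
  by rewrite !opprK !oppr0; apply: Pdiag.
by rewrite -mulrN; apply: Pdiag; lia.
Qed.
End CosetSum.

(** * Cosets of diagonal matrices *)

Lemma cmpz_scale (e x : int) : 0 < e -> cmpz (e * x) = cmpz x.
Proof.
move=> e0; case: (cmpzP x) => x0; last 2 first.
- by rewrite x0 mulr0.
- by case: (cmpzP (e * x)) => //; nia.
- by case: (cmpzP (e * x)) => //; nia.
Qed.

Lemma signs_of_scale (e a b c d : int) : 0 < e ->
  signs_of (e * a) (e * b) (e * c) (e * d) = signs_of a b c d.
Proof. by move=> e0; rewrite /signs_of -!mulrBr -!mulrDr -!mulrBr !cmpz_scale. Qed.

Section Diagonal.
Variables (m a b c d : int).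
Hypotheses (m0 : 0 < m) (D : a * d - b * c = 1) (nA : normal4 a c).

(** The matrix is diag(m, 1) g with g in Gamma. For each of the eight terms the inequalities bound
    products of entries, and a d - b c = 1 leaves few solutions. *)
Lemma coef_normal_diagonal : coef_normal (signs_of (m * a) (m * b) c d) != 0 ->
  [|| [&& a == 0, b == -1, c == 1 & d == -1],
      [&& a == 0, b == -1, c == 1 & d == 0],
      [&& a == 1, b == -1, c == 1 & d == 0] |
      [&& a == 1, b == 0, c == 0 & d == 1]].
Proof.
move=> /coef_normal_neq0 pieces; move: nA; rewrite /normal4 => nA'.
have mD : m * (- b * c) = m * (1 - a * d).
  by rewrite (_ : - b * c = 1 - a * d) //; move: D; lia.
move: pieces; rewrite /coefE /coefH /coefX /coefSXS /coefY /coefUYU /coefZ /coefUZU /=.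
rewrite !isgt_cmpz !islt_cmpz !iseq_cmpz.
rewrite !pmulr_rgt0 // !pmulr_rlt0 // subr_gt0 subr_lt0.
case/orP; [|case/orP; [|case/orP; [|case/orP; [|case/orP; [|case/orP; [|case/orP]]]]]].
- case: ifP => // /andP[c0 b0] /wt3_neq0[/cmpz_ge0 h3 /cmpz_le0 h4 /cmpz_le0 h5].
  have ad : a * d <= 0 by nia.
  have a0 : 0 <= a.
    rewrite leNgt; apply/negP => a0; have d0 : 0 <= d by nia.
    have : m * a < 0 by nia.
    lia.
  have d0 : d <= 0.
    rewrite leNgt; apply/negP => d0; have : 0 < a by nia.
    nia.
  (* The square is at most the product of the two upper bounds c and -m b of m a - d, that is m (1 -
     a d); thus (m a)^2 - m a d + d^2 <= m. *)
  have sq : (m * a - d) * (m * a - d) <= m * (- b * c).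
    have : (m * a - d) * (m * a - d) <= (m * - b) * c by apply: ler_pM; lia.
    lia.
  have ad0 : a * d = 0.
    apply/eqP; rewrite eq_le ad leNgt; apply/negP => ad1.
    have a1 : 1 <= a by nia.
    have : m <= m * a * (m * a) by nia.
    have : 0 <= d * d by nia.
    have : m * (a * d) < 0 by nia.
    lia.
  have bc : - b * c = 1 by lia.
  have b1 : b = -1 by nia.
  have c1 : c = 1 by nia.
  have [a1|a1] := eqVneq a 0; first by rewrite a1 in h3 h4 *; lia.
  have d1 : d = 0 by nia.
  have : a = 1 by nia.
  lia.
- case: ifP => // /andP[/eqP c0 a0] /wt_neq0[/cmpz_le0 h3 /cmpz_ge0 h4].
  have d0 : 0 < d by nia.
  have a1 : a = 1 by nia.
  have d1 : d = 1 by nia.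
  have b0 : 0 <= b by nia.
  have : b = 0 by nia.
  lia.
- case: ifP => // /andP[b0 d0] /wt_neq0[/cmpz_ge0 h3 /cmpz_ge0 h4].
  have a0 : 0 < a by nia.
  have c0 : 0 < c by nia.
  (* Two integers that are at least 1 cannot add up to a d - b c = 1. *)
  have : 1 <= a * d by nia. have : 1 <= - b * c by nia. lia.
- case: ifP => // /andP[c0 a0] /wt_neq0[/cmpz_le0 h3 /cmpz_le0 h4].
  have d0 : 0 < d by nia.
  have b0 : b < 0 by nia.
  have : 1 <= a * d by nia. have : 1 <= - b * c by nia. lia.
- case: ifP => // /andP[c0 ac] /wt_neq0[/cmpz_le0 h3 /cmpz_ge0 h4].
  have a0 : 0 < a by nia.
  have [b0|b0] := leP 0 b; last first.
    have ad : a * d <= 0 by nia.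
    have : d <= 0 by nia.
    lia.
  (* With b >= 0 this gives m a^2 + b (m a - c) <= 1, forcing m = a = 1, against 0 < c < m a. *)
  have : a * (m * a + m * b) <= a * d by apply: ler_wpM2l; lia.
  have : b <= b * (m * a - c) by nia.
  have : m * a <= a * (m * a) by nia.
  have : 1 <= m * a by nia.
  lia.
- case: ifP => // /andP[b0 d0] /wt_neq0[/cmpz_ge0 h3 /cmpz_ge0 h4].
  have c0 : 0 < c by nia.
  have a0 : 0 < a by nia.
  have : 1 <= a * d by nia. have : 1 <= - b * c by nia. lia.
- case: ifP => // /andP[a0 c0] /wt_neq0[/cmpz_le0 h3 /cmpz_le0 h4].
  have b0 : b < 0 by nia.
  have ad : a * d <= 0 by nia.
  have d0 : d <= 0 by nia.
  have sq : (m * a - d) * (m * a - d) <= m * (- b * c).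
    have : (m * a - d) * (m * a - d) <= (m * - b) * c.
      by rewrite [leRHS]mulrC; apply: ler_pM; lia.
    lia.
  have mad : m * (a * d) <= 0 by nia.
  have dd : 0 <= d * d by nia.
  (* As m a d <= 0, the estimate of the square leaves (m a)^2 <= m, hence m = a = 1. *)
  have ma : m * a * (m * a) <= m by lia.
  have m1 : m = 1 by nia.
  have a1 : a = 1 by rewrite m1 in ma; nia.
  rewrite m1 a1 in sq mad.
  have d1 : d = 0 by nia.
  have bc : - b * c = 1 by lia.
  have : c = 1 by nia.
  have : b = -1 by nia.
  lia.
- case: ifP => // /andP[b0 bd] /wt_neq0[/cmpz_ge0 h3 /cmpz_le0 h4].
  have [c0|c0] := ltP 0 c; last first.
    have c1 : c = 0 by lia.
    have a0 : 0 < a by lia.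
    have : d = 1 by nia.
    have : a = 1 by nia.
    nia.
  have a0 : 0 < a by nia.
  have d0 : d <= 0.
    rewrite leNgt; apply/negP => d0.
    have : 1 <= a * d by nia. have : 1 <= - b * c by nia. lia.
  (* By the determinant the right side is m (1 - a d), so m a - d + d^2 <= m; as a >= 1 and d <= 0,
     this gives d = 0 and a = 1. *)
  have : (1 - d) * (m * a - d) <= (m * - b) * c by apply: ler_pM; lia.
  have : m <= m * a by nia.
  have : 0 <= d * d by nia.
  move=> h6 h7 h8.
  have d1 : d = 0 by lia.
  rewrite d1 in h8 h7 *.
  have a1 : a = 1 by nia.
  have bc : - b * c = 1 by lia.
  have : c = 1 by nia.
  have : b = -1 by nia.
  lia.
Qed.
End Diagonal.

(** For m > 1 only E contributes: the fixed points of the first two matrices lie on the edges Re z =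
    1/2 and Re z = 0, giving -6 each. *)
Lemma coef_normal_diagonal_sum (m : int) : 0 < m ->
  coef_normal (signs_of (m * 0) (m * -1) 1 (-1)) +
  coef_normal (signs_of (m * 0) (m * -1) 1 0) +
  coef_normal (signs_of (m * 1) (m * -1) 1 0) +
  coef_normal (signs_of (m * 1) (m * 0) 0 1) = -12.
Proof.
(* At m = 1 further forms vanish, such as a - c for the third matrix, and the four terms are -4, -6,
   -4 and 2. *)
move=> m0; have [m1|m1] := eqVneq m 1; first by rewrite m1.
have v1 : signs_of (m * 0) (m * -1) 1 (-1) = Signs Eq Lt Gt Lt Gt Lt Lt Lt Lt Eq.
  by rewrite /signs_of !mulr0 mulrN1; congr Signs; case: cmpzP => //; lia.
have v2 : signs_of (m * 0) (m * -1) 1 0 = Signs Eq Lt Gt Eq Eq Lt Lt Lt Lt Lt.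
  by rewrite /signs_of !mulr0 mulrN1; congr Signs; case: cmpzP => //; lia.
have v3 : signs_of (m * 1) (m * -1) 1 0 = Signs Gt Lt Gt Eq Gt Lt Gt Lt Eq Gt.
  rewrite /signs_of mulr1 mulrN1 addrN !subr0.
  by congr Signs; case: cmpzP => //; lia.
have v4 : signs_of (m * 1) (m * 0) 0 1 = Signs Gt Eq Eq Gt Gt Eq Gt Lt Gt Gt.
  by rewrite /signs_of mulr1 mulr0 !subr0; congr Signs; case: cmpzP => //; lia.
by rewrite v1 v2 v3 v4.
Qed.

Section Coset.
Context {R : realType}.

Lemma coset_sum4_diagonal (m e : int) : 0 < m -> 0 < e ->
  coset_sum4 (R := R) (m * e) 0 0 e = -1.
Proof.
move=> m0 e0; have me0 : 0 < m * e by rewrite mulr_gt0.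
have DD : 0 < m * e * e - 0 * 0 by rewrite mulr0 subr0 mulr_gt0.
pose G1 := pm (mx2 0 (-1) 1 (-1)); pose G2 := pm (mx2 0 (-1) 1 0).
pose G3 := pm (mx2 1 (-1) 1 0); pose G4 := pm (mx2 1 0 0 1).
(* The product is e times [[m a, m b], [c, d]], and the positive factor e does not affect any
   sign. *)
have value (a b c d : int) : a * d - b * c = 1 -> normal4 a c ->
    Ttilde R (Mmul (pm (mx2 (m * e) 0 0 e)) (pm (mx2 a b c d))) =
    (coef_normal (signs_of (m * a) (m * b) c d))%:~R / 12.
  move=> D nA; have D1 : 0 < a * d - b * c by rewrite D.
  have D2 : 0 < e * (m * a) * (e * d) - e * (m * b) * (e * c) by nia.
  rewrite (Mmul_pm2 DD D1) (@pm2_eq _ _ _ _ (e * (m * a)) (e * (m * b)) (e * c) (e * d)); [|lia..].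
  rewrite (Ttilde_pm D2) signs_of_scale // /coef normal_signs_of (_ : normal4 _ _) //.
  by move: nA; rewrite /normal4; nia.
have det1 g : Gamma g -> exists a b c d : int,
    [/\ a * d - b * c = 1, normal4 a c & g = pm (mx2 a b c d)].
  move=> Gg; exists (rep g 0 0), (rep g 0 1), (rep g 1 0), (rep g 1 1).
  rewrite -mx2_eta repK -det2 Gg; split=> //.
  by case/andP: (matpmP g).
have us : uniq [:: G1; G2; G3; G4].
  apply: (@map_uniq _ _ (fun g => (rep g 0 0, rep g 1 1))).
  by rewrite /= !rep_pm ?det_mx2 // !pos_rep_mx2 /= !mx2E.
have sG : [set` [:: G1; G2; G3; G4]] `<=` Gamma.
  move=> g; rewrite /= !inE /Gamma /detn /= => /or4P[]/eqP->;
    by rewrite det_rep_pm det_mx2.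
rewrite /coset_sum4 /coset_sum -(fsbig_widen _ _ _ sG); last first.
  move=> g [Gg ng] /=; have [a [b [c [d [D nA gE]]]]] := det1 g Gg.
  rewrite gE value //; suff -> : coef_normal (signs_of (m * a) (m * b) c d) = 0 by rewrite mul0r.
  apply: contra_notP ng => /eqP /(coef_normal_diagonal m0 D nA) h.
  rewrite gE /= !inE; case/or4P: h => /and4P[/eqP-> /eqP-> /eqP-> /eqP->];
    by rewrite eqxx ?orbT.
have sum4 (f : matpm -> R) g1 g2 g3 g4 w1 w2 w3 w4 :
    f g1 = w1 -> f g2 = w2 -> f g3 = w3 -> f g4 = w4 ->
    \sum_(g <- [:: g1; g2; g3; g4]) f g = w1 + w2 + w3 + w4.
  by move=> <- <- <- <-; rewrite !big_cons big_nil addr0 !addrA.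
transitivity (\sum_(g <- [:: G1; G2; G3; G4]) Ttilde R (Mmul (pm (mx2 (m * e) 0 0 e)) g)).
  exact: esym (fsbig_seq _ _ us).
have v1 := value 0 (-1) 1 (-1) erefl erefl; have v2 := value 0 (-1) 1 0 erefl erefl.
have v3 := value 1 (-1) 1 0 erefl erefl; have v4 := value 1 0 0 1 erefl erefl.
rewrite (sum4 (fun g => Ttilde R (Mmul (pm (mx2 (m * e) 0 0 e)) g))
  _ _ _ _ _ _ _ _ v1 v2 v3 v4).
rewrite -!mulrDl -!intrD.
rewrite (coef_normal_diagonal_sum m0).
by rewrite -[LHS]/(- (12%:~R) / 12) mulNr divff // intr_eq0.
Qed.

Lemma pairing_T M : pairing (Ttilde R) (Mmul M @` Gamma) = -1.
Proof.
rewrite pairing_coset_sum; have [a [b [c [d [D ->]]]]] := matpm_pm2 M.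
by apply: (@coset_sum4_Smith R (fun x => x = -1)) => // m e; exact: coset_sum4_diagonal.
Qed.
End Coset.

Theorem theorem4 (R : realType) :
  [/\ Rhat (Ttilde R),
      (fmul piU @` Rhat) (fmul (Ttilde R) piS) /\
      (fmul piS @` Rhat) (fmul (Ttilde R) piU),
      forall n : nat, (1 <= n)%N ->
        (fmul (fone + fU + fU2) @` QM n)
          (fmul (component n (Ttilde R)) (fone + fS)) /\
        (fmul (fone + fS) @` QM n)
          (fmul (component n (Ttilde R)) (fone + fU + fU2)) &
      forall M : matpm, pairing (Ttilde R) (Mmul M @` Gamma) = -1].
Proof.
split.
- exact: Rhat_T.
- by split; [exact: T_piS|exact: T_piU].
- by move=> n _; split; [exact: Tn_oneS|exact: Tn_oneU].
- exact: pairing_T.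
Qed.
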